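(* Let $\Bbbk$ be a finite or countable field and let $\mathbb K$ be a finitely generated field extension of $\Bbbk$ of transcendence degree at least $2$. Then $\mathrm{ZR}(\mathbb K/\Bbbk)$ is a Cantor set for the Patch topology.
   Context: $\mathrm{ZR}(\mathbb K/\Bbbk)$ is the set of valuations $\nu:\mathbb K\to\Gamma_\nu\cup\{\infty\}$ on $\mathbb K$ (with $\Gamma_\nu$ a totally ordered abelian group, the trivial valuation being allowed) that are trivial on $\Bbbk$ ($\nu(a)=0$ for $a\in\Bbbk\setminus\{0\}$), two valuations being identified when they have the same valuation ring. The Patch topology is the topology generated by the sets $\mathcal O(x)=\{\nu\mid\nu(x)\geq0\}$ and $\mathcal U(x)=\{\nu\mid\nu(x)>0\}$, $x\in\mathbb K$. A Cantor set is a non-empty, compact, metrizable, totally disconnected space without isolated points. *)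

(* Defs.v *)
From HB Require Import structures.
From mathcomp Require Import all_boot all_order all_algebra.
From mathcomp Require mpoly.

Set Implicit Arguments.
Unset Strict Implicit.
Unset Printing Implicit Defensive.

Import Order.TTheory GRing.Theory Num.Theory.

(* The notations of mpoly clash with those of mathcomp-analysis, hence its
   import is confined to this module. *)
Module AlgebraicIndependence.
Import mpoly.
Local Open Scope ring_scope.

Definition algebraically_independent (k K : fieldType)
    (iota : {rmorphism k -> K}) n (B : n.-tuple K) : Prop :=
  forall p : {mpoly k[n]}, mmap iota (tnth B) p = 0 -> p = 0.

End AlgebraicIndependence.
Export AlgebraicIndependence.

From mathcomp Require Import boolp classical_sets functions cardinality.
From mathcomp Require Import reals topology.

Local Open Scope classical_set_scope.
Local Open Scope ring_scope.

Section FieldExtension.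
Variables (k K : fieldType) (iota : {rmorphism k -> K}).

(* The subfield k(S) of K: the intersection of all subfields of K containing
   iota(k) and S. *)
Definition adjoin (S : seq K) : set K :=
  [set x | forall F : {pred K}, GRing.divring_closed F ->
     (forall a : k, iota a \in F) -> {subset S <= F} -> x \in F].

Definition finitely_generated : Prop :=
  exists S : seq K, adjoin S = [set: K].

Definition algebraic_over (F : set K) (x : K) : Prop :=
  exists p : {poly K}, [/\ p != 0, forall i, F p`_i & root p x].

Definition transcendence_basis n (B : n.-tuple K) : Prop :=
  algebraically_independent iota B /\ forall x, algebraic_over (adjoin B) x.

Definition has_trdeg (n : nat) : Prop :=
  exists B : n.-tuple K, transcendence_basis B.

End FieldExtension.

Section ExtendedGroup.
Variable G : porderZmodType.

(* G extended with an element oo, encoded as [None], that is larger than every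
   element of G and absorbing for the addition. *)
Definition ext_le (a b : option G) : bool :=
  match a, b with
  | _, None => true
  | None, Some _ => false
  | Some a', Some b' => a' <= b'
  end.

Definition ext_lt (a b : option G) : bool := ext_le a b && (a != b).

Definition ext_min (a b : option G) : option G := if ext_le a b then a else b.

Definition ext_add (a b : option G) : option G :=
  match a, b with
  | Some a', Some b' => Some (a' + b')
  | _, _ => None
  end.

End ExtendedGroup.

(* [porderZmodType] imposes no compatibility between the order and the
   addition, hence the fields [value_total] and [value_leD]. *)
Record valuation (K : fieldType) := Valuation {
  value_group : porderZmodType;
  value_total : forall a b : value_group, (a <= b) || (b <= a);
  value_leD : forall c a b : value_group, a <= b -> a + c <= b + c;
  vfun :> K -> option value_group;
  vfun_oo : forall x, vfun x = None <-> x = 0;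
  vfunM : forall x y, vfun (x * y) = ext_add (vfun x) (vfun y);
  vfunD : forall x y, ext_le (ext_min (vfun x) (vfun y)) (vfun (x + y))
}.

Section ZariskiRiemann.
Variables (k K : fieldType) (iota : {rmorphism k -> K}).

Definition valuation_ring (v : valuation K) : set K :=
  [set x | ext_le (Some 0) (v x)].

Definition trivial_on_base (v : valuation K) : Prop :=
  forall a : k, a != 0 -> v (iota a) = Some 0.

(* The quotient of the class of valuations trivial on k by the relation "same
   valuation ring", realized as the image of v |-> valuation_ring v; see
   [zr_class_eq] and [zr_class_surj]. *)
Definition ZR : Type :=
  {A : set K | exists v : valuation K, trivial_on_base v /\ A = valuation_ring v}.

Definition zr_class (v : valuation K) (tv : trivial_on_base v) : ZR :=
  exist _ (valuation_ring v) (ex_intro _ v (conj tv erefl)).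

Lemma zr_class_eq (v w : valuation K) (tv : trivial_on_base v)
    (tw : trivial_on_base w) :
  zr_class tv = zr_class tw <-> valuation_ring v = valuation_ring w.
Proof.
split=> [[]//|e]; rewrite /zr_class; apply: eq_exist => //.
Qed.

Lemma zr_class_surj (p : ZR) :
  exists (v : valuation K) (tv : trivial_on_base v), p = zr_class tv.
Proof.
case: p => A [v [tv e]]; exists v, tv; subst A; exact: eq_exist.
Qed.

(* O(x) and U(x): the classes of the valuations with v x >= 0, resp. v x > 0.
   Both conditions depend only on the valuation ring of v. *)
Definition zr_nonneg (x : K) : set ZR :=
  [set p | exists (v : valuation K) (tv : trivial_on_base v),
     p = zr_class tv /\ ext_le (Some 0) (v x)].

Definition zr_pos (x : K) : set ZR :=
  [set p | exists (v : valuation K) (tv : trivial_on_base v),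
     p = zr_class tv /\ ext_lt (Some 0) (v x)].

Definition patch_subbase : set (set ZR) :=
  [set B | exists x, B = zr_nonneg x \/ B = zr_pos x].

HB.instance Definition _ := gen_eqMixin ZR.
HB.instance Definition _ := gen_choiceMixin ZR.
HB.instance Definition _ :=
  @isSubBaseTopological.Build ZR (set ZR) patch_subbase id.

End ZariskiRiemann.

Section CantorSet.
Variables (R : realType) (T : topologicalType).

Definition is_metric (d : T -> T -> R) : Prop :=
  [/\ forall x y, 0 <= d x y,
      forall x y, d x y = 0 <-> x = y,
      forall x y, d x y = d y x &
      forall x y z, d x z <= d x y + d y z].

Definition metrizable : Prop :=
  exists d : T -> T -> R, is_metric d /\
    forall (x : T) (A : set T),
      nbhs x A <-> exists2 e : R, 0 < e & [set y | d x y < e] `<=` A.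

Definition cantor_set : Prop :=
  [/\ [set: T] !=set0, compact [set: T], metrizable,
      totally_disconnected [set: T] & isolated [set: T] = set0].

End CantorSet.

(* Main.v *)
Require Import Defs.
From HB Require Import structures.
From mathcomp Require Import all_boot all_order all_algebra.
From mathcomp Require mpoly.
From mathcomp Require Import finmap.
From mathcomp Require Import boolp classical_sets functions cardinality.
From mathcomp Require Import reals topology.
From mathcomp Require Import ring.


(** Identify a valuation with its valuation ring A, a subring of K that contains
    k and, for each x in K, contains x or 1/x. In the patch topology, membership
    in A is tested on one element of K at a time, and each test is open and
    closed. As K is countable, this gives an ultrametric space in which distinct
    points are separated by clopen sets; it is compact because the ring axioms
    and the alternative between x and 1/x pass to the limit along an ultrafilter
    ([zr_compact]). The substance of the theorem is that no valuation ring A is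
    isolated ([not_isolated]).

    An isolated A would be the only valuation ring that contains a finite set S
    and has a finite set T in its maximal ideal m. The argument by contradiction
    rests on Chevalley's theorem ([vring_exists]): unless T generates the unit
    ideal of a ring R, some valuation ring contains R and has T in its maximal
    ideal. Thus uniqueness of A turns into algebraic identities. Integral closures
    are intersections of valuation rings throughout, so that the same theorem
    also provides all integral equations ([integral_monic_root]).

    Let R = k[S]. First, elements of R are algebraic over k modulo m
    ([isolated_residue_algebraic]): otherwise, by Noether normalization in the
    residue field of A, there would be a proper valuation ring of the residue
    field containing the image of R; composing it with A gives a smaller
    valuation ring with the same properties with respect to S and T.

    Next, enlarge S by two algebraically independent elements. By Noether
    normalization ([noether_normalization]) R is integral over a polynomial ring
    k[y, y2, ...], with at least two variables by [alg_indep_size_ge2]. Polynomials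
    Y in y and b in y2 can be chosen in m, with b / Y in A. By uniqueness no
    valuation ring as above has Y / b in its maximal ideal, so that the theorem of
    Chevalley gives a relation g b^n = Y r with g and r in R and g congruent to 1
    modulo m. Now P = k[y2, ...][Y] is integrally closed
    ([integrally_closed_adj_seq]), R is integral over it, and Y is a prime of P
    that does not divide b. Comparing the minimal polynomials of g and r over the
    fraction field of P shows that the non-leading coefficients of that of g are
    divisible by Y ([integral_dvd_gen]). Hence a power of g is in m, which
    contradicts g = 1 modulo m. *)

Set Implicit Arguments.
Unset Strict Implicit.
Unset Printing Implicit Defensive.

Import Order.TTheory GRing.Theory Num.Theory.

(** * Algebraically independent elements *)

(* The notations of multivariate polynomials stay confined to this module. *)
Module BivariateIndependence.
Import mpoly.
Local Open Scope ring_scope.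

Lemma alg_independent_bivariate (k K : fieldType) (iota : {rmorphism k -> K})
    n (B : n.-tuple K) (i1 i2 : 'I_n) (f : nat -> nat -> k) M N :
  i1 != i2 -> algebraically_independent iota B ->
  \sum_(j < N) \sum_(i < M) iota (f i j) * tnth B i1 ^+ i * tnth B i2 ^+ j = 0 ->
  forall i j, (i < M)%N -> (j < N)%N -> f i j = 0.
Proof.
move=> ne12 indB; pose m i j := (U_(i1) *+ i + U_(i2) *+ j)%MM.
have m1 i j : m i j i1 = i.
  by rewrite mnmDE !mulmnE !mnm1E eqxx eq_sym (negPf ne12) mul1n mul0n addn0.
have m2 i j : m i j i2 = j.
  by rewrite mnmDE !mulmnE !mnm1E eqxx (negPf ne12) mul1n mul0n.
pose p : {mpoly k[n]} := \sum_(j < N) \sum_(i < M) f i j *: 'X_[m i j].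
have pE : mmap iota (tnth B) p =
    \sum_(j < N) \sum_(i < M) iota (f i j) * tnth B i1 ^+ i * tnth B i2 ^+ j.
  rewrite raddf_sum; apply: eq_bigr => j _; rewrite raddf_sum.
  apply: eq_bigr => i _; rewrite /= mmapZ -mulrA; congr (_ * _).
  by rewrite mpolyXD -!mpolyXn rmorphM !rmorphXn/= !mmapX !mmap1U.
rewrite -pE => /indB p0 i j ltiM ltjN.
have := congr1 (mcoeff (m i j)) p0; rewrite mcoeff0 raddf_sum/=.
under eq_bigr => j' _ do rewrite raddf_sum/=.
rewrite (bigD1 (Ordinal ltjN))//= [X in _ + X]big1 ?addr0 => [|j' nej]; last first.
  apply: big1 => i' _; rewrite mcoeffZ mcoeffX.
  rewrite (_ : _ == _ = false) ?mulr0//; apply/negbTE; apply: contra nej => /eqP e.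
  by apply/eqP/val_inj; rewrite /= -(m2 i j) -e m2.
rewrite (bigD1 (Ordinal ltiM))//= [X in _ + X]big1 ?addr0 => [|i' nei]; last first.
  rewrite mcoeffZ mcoeffX.
  rewrite (_ : _ == _ = false) ?mulr0//; apply/negbTE; apply: contra nei => /eqP e.
  by apply/eqP/val_inj; rewrite /= -(m1 i j) -e m1.
by rewrite mcoeffZ mcoeffX eqxx mulr1.
Qed.

End BivariateIndependence.
Import BivariateIndependence.

Local Open Scope classical_set_scope.
Local Open Scope ring_scope.

(** * Subrings, adjunction, generated ideals *)

Definition subring (D : nzRingType) (B : set D) : Prop :=
  [/\ B 1, forall x y, B x -> B y -> B (x - y)
    & forall x y, B x -> B y -> B (x * y)].

Section SubringTheory.
Variables (D : nzRingType) (B : set D).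
Hypothesis rB : subring B.

Lemma subring1 : B 1. Proof. by case: rB. Qed.
Lemma subringB x y : B x -> B y -> B (x - y). Proof. by case: rB => _ h _; exact: h. Qed.
Lemma subringM x y : B x -> B y -> B (x * y). Proof. by case: rB => _ _ h; exact: h. Qed.
Lemma subring0 : B 0.
Proof. by have := subringB subring1 subring1; rewrite subrr. Qed.
Lemma subringN x : B x -> B (- x).
Proof. by move=> Bx; rewrite -sub0r; apply: subringB => //; exact: subring0. Qed.
Lemma subringD x y : B x -> B y -> B (x + y).
Proof. by move=> Bx By; rewrite -[y]opprK; apply: subringB => //; exact: subringN. Qed.
Lemma subringX x n : B x -> B (x ^+ n).
Proof.
move=> Bx; elim: n => [|n IHn]; first by rewrite expr0; exact: subring1.
by rewrite exprS; exact: subringM.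
Qed.
Lemma subring_sum (I : eqType) (r : seq I) (F : I -> D) :
  (forall i, i \in r -> B (F i)) -> B (\sum_(i <- r) F i).
Proof.
move=> BF; rewrite big_seq; elim/big_ind: _ => //; first exact: subring0.
exact: subringD.
Qed.
Lemma subring_sum_ord n (F : 'I_n -> D) :
  (forall i, B (F i)) -> B (\sum_i F i).
Proof. by move=> BF; apply: subring_sum => i _; exact: BF. Qed.

End SubringTheory.

(** Rings between k and K are sets, so that they can be intersected and obtained
    from Zorn's lemma; B[X] is accordingly a set of polynomials over K. *)
Definition polys_over (D : nzRingType) (B : set D) : set {poly D} :=
  [set p | forall i, B p`_i].

Lemma polys_over_subring (D : nzRingType) (B : set D) :
  subring B -> subring (polys_over B).
Proof.
move=> rB; split=> [i|p q Bp Bq i|p q Bp Bq i].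
- by rewrite coef1; case: (_ == _); [exact: subring1|exact: subring0].
- by rewrite coefB; exact: (subringB rB).
- by rewrite coefM; apply: (subring_sum_ord rB) => j; exact: (subringM rB).
Qed.

Lemma polys_overS (D : nzRingType) (B C : set D) :
  B `<=` C -> polys_over B `<=` polys_over C.
Proof. by move=> BC p Bp i; exact/BC/Bp. Qed.

Section PolysOver.
Variables (D : nzRingType) (B : set D).
Hypothesis rB : subring B.

Lemma polys_overC c : B c -> polys_over B c%:P.
Proof. by move=> Bc i; rewrite coefC; case: (_ == _) => //; exact: subring0. Qed.
Lemma polys_overX : polys_over B 'X.
Proof. by move=> i; rewrite coefX; case: (_ == _); [exact: subring1|exact: subring0]. Qed.
Lemma polys_overXn n : polys_over B 'X^n.
Proof. by apply: (subringX (polys_over_subring rB)); exact: polys_overX. Qed.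
Lemma polys_overZ c p : B c -> polys_over B p -> polys_over B (c *: p).
Proof. by move=> Bc Bp i; rewrite coefZ; exact: subringM. Qed.
Lemma polys_over_poly n (E : nat -> D) :
  (forall i, (i < n)%N -> B (E i)) -> polys_over B (\poly_(i < n) E i).
Proof.
by move=> BE i; rewrite coef_poly; case: ifP => [/BE//|_]; exact: subring0.
Qed.

End PolysOver.

Lemma horner_closed (D : nzRingType) (B C : set D) p x :
  subring C -> B `<=` C -> C x -> polys_over B p -> C p.[x].
Proof.
move=> rC BC Cx Bp; rewrite horner_coef; apply: (subring_sum_ord rC) => i.
by apply: subringM => //; [exact/BC/Bp|exact: subringX].
Qed.

Definition adj_ring (D : nzRingType) (B : set D) (y : D) : set D :=
  [set p.[y] | p in polys_over B].

Section AdjRing.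
Variables (D : comNzRingType) (B : set D) (y : D).
Hypothesis rB : subring B.

Lemma adj_ring_subring : subring (adj_ring B y).
Proof.
have rBX := polys_over_subring rB; split.
- by exists 1; [exact: subring1|rewrite hornerE].
- move=> _ _ [p Bp <-] [q Bq <-]; exists (p - q); first exact: (subringB rBX).
  by rewrite !hornerE.
- move=> _ _ [p Bp <-] [q Bq <-]; exists (p * q); first exact: (subringM rBX).
  by rewrite hornerM.
Qed.

Lemma adj_ring_base : B `<=` adj_ring B y.
Proof. by move=> b Bb; exists b%:P; [exact: polys_overC|rewrite hornerC]. Qed.

Lemma adj_ring_gen : adj_ring B y y.
Proof. by exists 'X; [exact: polys_overX|rewrite hornerX]. Qed.

Lemma adj_ring_min (C : set D) :
  subring C -> B `<=` C -> C y -> adj_ring B y `<=` C.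
Proof. by move=> rC BC Cy _ [p Bp <-]; exact: horner_closed Bp. Qed.

End AdjRing.

(** Inductive, so that each element of the ideal visibly involves finitely many
    multipliers: the ideal then commutes with unions of chains of rings. *)
Inductive ideal_span (D : nzRingType) (T R : set D) : set D :=
| IdealSpan0 : ideal_span T R 0
| IdealSpanD t r x : T t -> R r -> ideal_span T R x ->
    ideal_span T R (t * r + x).

Section IdealSpan.
Variables (D : comNzRingType) (T : set D).

Lemma ideal_spanS (R R' : set D) :
  R `<=` R' -> ideal_span T R `<=` ideal_span T R'.
Proof.
move=> RR' u; elim=> [|t r x Tt /RR' R'r _ ih]; first exact: IdealSpan0.
exact: IdealSpanD.
Qed.

Lemma ideal_span_sub (J R : set D) :
  J 0 -> (forall x y, J x -> J y -> J (x + y)) ->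
  (forall t r, T t -> R r -> J (t * r)) -> ideal_span T R `<=` J.
Proof. by move=> J0 JD JM u; elim=> // t r x Tt Rr _ Jx; apply: JD => //; exact: JM. Qed.

Variable R : set D.
Hypothesis rR : subring R.

Lemma ideal_span_gen t : T t -> ideal_span T R t.
Proof.
move=> Tt; rewrite -[t]addr0 -[t]mulr1.
by apply: IdealSpanD => //; [exact: subring1|exact: IdealSpan0].
Qed.

Lemma ideal_span_add x y :
  ideal_span T R x -> ideal_span T R y -> ideal_span T R (x + y).
Proof.
move=> + Ty; elim=> [|t r z Tt Rr _ ih]; first by rewrite add0r.
by rewrite -addrA; exact: IdealSpanD.
Qed.

Lemma ideal_span_mul x y : ideal_span T R x -> R y -> ideal_span T R (x * y).
Proof.
move=> + Ry; elim=> [|t r z Tt Rr _ ih]; first by rewrite mul0r; exact: IdealSpan0.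
by rewrite mulrDl -mulrA; apply: IdealSpanD => //; exact: (subringM rR).
Qed.

Lemma ideal_span_sum (I : eqType) (r : seq I) (F : I -> D) :
  (forall i, i \in r -> ideal_span T R (F i)) ->
  ideal_span T R (\sum_(i <- r) F i).
Proof.
move=> JF; rewrite big_seq; elim/big_ind: _ => //; first exact: IdealSpan0.
exact: ideal_span_add.
Qed.

(** The extension of an ideal I from R to R[y] consists of the values at [y] of
    polynomials with coefficients in I. *)
Lemma ideal_span_adj x y : T `<=` R -> ideal_span T (adj_ring R y) x ->
  exists2 a : {poly D}, polys_over (ideal_span T R) a & x = a.[y].
Proof.
move=> TR; elim=> [|t _ z Tt [p Rp <-] _ [a Ja ->]].
  by exists 0; [move=> i; rewrite coef0; exact: IdealSpan0|rewrite horner0].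
exists (t *: p + a); last by rewrite hornerD hornerZ.
by move=> i; rewrite coefD coefZ; exact: IdealSpanD.
Qed.

End IdealSpan.

(** * Valuation rings *)

Definition vring (K : fieldType) (A : set K) : Prop :=
  subring A /\ forall x, A x \/ A x^-1.

(** The maximal ideal of a valuation ring: if the inverse of [x] is not in [A],
    then [x] itself is. *)
Definition mideal (K : fieldType) (A : set K) : set K :=
  [set x | x = 0 \/ ~ A x^-1].

Section VRing.
Variables (K : fieldType) (A : set K).
Hypothesis vA : vring A.

Lemma vring_subring : subring A. Proof. by case: vA. Qed.
Let rA := vring_subring.

Lemma mideal_sub : mideal A `<=` A.
Proof.
move=> x [->|nAx]; first exact: subring0 rA.
by case: vA => _ /(_ x) [].
Qed.

Lemma mideal1 : ~ mideal A 1.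
Proof. by case=> [/eqP|]; [rewrite oner_eq0|rewrite invr1; case; exact: subring1]. Qed.

Lemma mideal0 : mideal A 0. Proof. by left. Qed.

Lemma vring_notin x : ~ A x -> mideal A x^-1.
Proof. by move=> nAx; right; rewrite invrK. Qed.

Lemma midealM x y : mideal A x -> A y -> mideal A (x * y).
Proof.
case=> [->|nAx] Ay; first by left; rewrite mul0r.
have [->|y0] := eqVneq y 0; first by left; rewrite mulr0.
right=> Axy; apply: nAx.
have -> : x^-1 = (x * y)^-1 * y by rewrite invfM mulfVK.
exact: (subringM rA).
Qed.

Lemma midealMl x y : A x -> mideal A y -> mideal A (x * y).
Proof. by move=> Ax my; rewrite mulrC; exact: midealM. Qed.

Lemma midealN x : mideal A x -> mideal A (- x).
Proof. by move=> mx; rewrite -mulrN1; apply: midealM => //; exact: (subringN rA (subring1 rA)). Qed.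

Lemma midealV x : A x -> ~ mideal A x -> A x^-1.
Proof. by move=> Ax nmx; apply: contrapT => nAx; apply: nmx; right. Qed.

Lemma midealD x y : mideal A x -> mideal A y -> mideal A (x + y).
Proof.
have aux u v : mideal A u -> mideal A v -> v != 0 -> A (u / v) -> mideal A (u + v).
  move=> mu mv v0 Auv; rewrite -[v in u + v]mul1r -[u in u + _](@divfK _ v)//.
  by rewrite -mulrDl; apply: midealMl => //; apply: subringD => //; exact: subring1.
move=> mx my; have [->|x0] := eqVneq x 0; first by rewrite add0r.
have [->|y0] := eqVneq y 0; first by rewrite addr0.
case: (vA.2 (x / y)) => [Axy|]; first exact: aux.
by rewrite invf_div => Ayx; rewrite addrC; exact: aux.
Qed.

Lemma mideal_sum_ord n (F : 'I_n -> K) :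
  (forall i, mideal A (F i)) -> mideal A (\sum_i F i).
Proof. by move=> mF; elim/big_ind: _ => //; [exact: mideal0|exact: midealD]. Qed.

Lemma mideal_prime x y : A x -> A y -> mideal A (x * y) -> mideal A x \/ mideal A y.
Proof.
move=> Ax Ay mxy; apply: contrapT => /not_orP[nx ny]; apply: mideal1.
have x0 : x != 0 by apply/eqP => x0; apply: nx; left.
have y0 : y != 0 by apply/eqP => y0; apply: ny; left.
have -> : 1 = (x * y) * (x^-1 * y^-1) by rewrite -invfM divff// mulf_neq0.
by apply: midealM => //; apply: subringM => //; exact: midealV.
Qed.

Lemma mideal_pow x n : A x -> mideal A (x ^+ n) -> mideal A x.
Proof.
move=> Ax; elim: n => [|n IHn]; first by rewrite expr0 => /mideal1.
rewrite exprS => /mideal_prime; case=> //.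
by apply: subringX => //; exact: vring_subring.
Qed.

(** If [x] were not in [A], then its inverse would be in the maximal ideal, and
    dividing the equation by the top power of [x] would put 1 there too. *)
Lemma vring_root (q : {poly K}) x :
  polys_over A q -> q != 0 -> A (lead_coef q)^-1 -> root q x -> A x.
Proof.
move=> Aq q0 Alc /rootP qx; apply: contrapT => nAx.
have x0 : x != 0.
  by apply/eqP => x0; apply: nAx; rewrite x0; exact: subring0.
have mx := vring_notin nAx; have lc0 : lead_coef q != 0 by rewrite lead_coef_eq0.
apply: mideal1; move: qx; rewrite horner_coef.
rewrite -(@prednK (size q)) ?lt0n ?size_poly_eq0// big_ord_recr/= => /eqP.
rewrite -lead_coefE addrC addr_eq0 => /eqP e.
have -> : 1 = - \sum_(i < (size q).-1)
    (lead_coef q)^-1 * q`_i * (x^-1) ^+ ((size q).-1 - i)%N.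
  have xn0 : x ^+ (size q).-1 != 0 by rewrite expf_neq0.
  apply: (mulIf (mulf_neq0 lc0 xn0)); rewrite mul1r [LHS]e mulNr.
  congr (- _); rewrite mulr_suml; apply: eq_bigr => i _; rewrite exprVn.
  have := ltnW (ltn_ord i); set m := (size q).-1 => le_im.
  have -> : x ^+ m = x ^+ (m - i) * x ^+ i by rewrite -exprD subnK.
  by field; rewrite lc0 expf_neq0.
apply: midealN; apply: mideal_sum_ord => i.
rewrite -[X in mideal A X]mulrA; apply: midealMl => //; apply: midealMl; first exact: Aq.
rewrite -(@prednK (_ - i)) ?subn_gt0// exprS; apply: midealM => //.
by apply: subringX => //; exact: mideal_sub.
Qed.

End VRing.

(** * Existence of valuation rings *)

Section Chevalley.
Variables (K : fieldType) (T : set K).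

Section Maximal.
Variable R : set K.
Hypotheses (rR : subring R) (TR : T `<=` R) (properR : ~ ideal_span T R 1).
Hypothesis maxR : forall R' : set K, subring R' -> R `<=` R' ->
  ~ ideal_span T R' 1 -> R' `<=` R.

Let J := ideal_span T R.

Let JR : J `<=` R.
Proof.
apply: ideal_span_sub; first exact: subring0.
  by move=> x y; exact: subringD.
by move=> t r /TR; exact: subringM.
Qed.

Let J1X j n : J j -> J (1 - (1 - j) ^+ n).
Proof.
move=> Jj; elim: n => [|n IHn]; first by rewrite expr0 subrr; exact: IdealSpan0.
have -> : 1 - (1 - j) ^+ n.+1 = 1 - (1 - j) ^+ n + j * (1 - j) ^+ n.
  by rewrite exprS; ring.
apply: ideal_span_add => //; apply: (ideal_span_mul rR) => //.
by apply: subringX => //; apply: subringB => //; [exact: subring1|exact: JR].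
Qed.

(** Inverting u = 1 - j keeps the ideal proper: a relation over R[1/u] gives,
    after multiplication by a power of [u], a power of [u] in J, whereas all
    powers of [u] are congruent to 1 modulo J. By maximality 1/u is in R. *)
Lemma maximal_inv1B j : J j -> R (1 - j)^-1.
Proof.
move=> Jj; set u := 1 - j.
have u0 : u != 0 by rewrite subr_eq0; apply/eqP => j1; apply: properR; rewrite j1.
have Ru : R u by apply: subringB => //; [exact: subring1|exact: JR].
have rR' := adj_ring_subring u^-1 rR.
suff h : adj_ring R u^-1 `<=` R by apply: h; exact: adj_ring_gen.
apply: maxR => //; first exact: adj_ring_base.
move=> /(ideal_span_adj TR)[a Ja a1].
suff Jun : J (u ^+ (size a)).
  apply: properR; rewrite -[1](subrK (u ^+ size a)).
  by apply: ideal_span_add => //; exact: J1X.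
have -> : u ^+ size a = \sum_(i < size a) a`_i * u ^+ (size a - i).
  rewrite -[LHS]mul1r a1 horner_coef mulr_suml; apply: eq_bigr => i _.
  have := ltnW (ltn_ord i); set m := size a => le_im.
  have -> : u ^+ m = u ^+ (m - i) * u ^+ i by rewrite -exprD subnK.
  by rewrite exprVn; field; rewrite expf_neq0.
apply: (ideal_span_sum (T := T) (R := R)) => i _.
by apply: (ideal_span_mul rR); [exact: Ja|exact: subringX].
Qed.

(** By [maximal_inv1B] the constant term of the shorter relation can be moved to
    the left, so that this relation rewrites the top term of the longer one by
    terms of lower degree. *)
Lemma maximal_no_relations N (a b : {poly K}) x : x != 0 ->
  (size a + size b <= N)%N -> polys_over J a -> polys_over J b ->
  a.[x] = 1 -> b.[x^-1] = 1 -> False.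
Proof.
elim: N a b x => [|N IHN] a b x x0.
  rewrite leqn0 addn_eq0 size_poly_eq0 => /andP[/eqP -> _] _ _.
  by rewrite horner0 => /esym/eqP; rewrite oner_eq0.
wlog le_ba : a b x x0 / (size b <= size a)%N => [wl|] le_abN Ja Jb ax bx.
  have [le_ba|/ltnW le_ab] := leqP (size b) (size a); first exact: (wl a b x).
  by apply: (wl b a x^-1); rewrite ?invr_eq0 ?invrK 1?addnC.
case sa : (size a) => [|n].
  by move/eqP: sa ax; rewrite size_poly_eq0 => /eqP ->; rewrite horner0 => /esym/eqP;
    rewrite oner_eq0.
set u := 1 - b`_0; have Ruv : R u^-1 by apply: maximal_inv1B; exact: Jb.
have u0 : u != 0 by rewrite subr_eq0; apply/eqP => b1; apply: properR; rewrite b1; exact: Jb.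
pose a' := \poly_(i < n) (a`_i + a`_n * (u^-1 * b`_(n - i)%N)).
apply: (IHN a' b x) => //.
- rewrite -ltnS; apply: leq_trans le_abN; rewrite sa addSn ltnS leq_add2r.
  exact: size_poly.
- move=> i; rewrite coef_poly; case: ifP => _; last exact: IdealSpan0.
  apply: ideal_span_add; first exact: Ja.
  apply: (ideal_span_mul rR); first exact: Ja.
  by apply: subringM => //; apply: JR; exact: Jb.
- rewrite horner_poly -ax horner_coef sa big_ord_recr/=.
  under eq_bigr do rewrite mulrDl.
  rewrite big_split/=; congr (_ + _).
  under eq_bigr do rewrite -2!mulrA.
  rewrite -!mulr_sumr; congr (_ * _).
  apply: (mulfI u0); rewrite mulVKf//.
  have : 1 = \sum_(i < n.+1) b`_i * x^-1 ^+ i.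
    rewrite -bx (@horner_coef_wide _ n.+1)//.
    by rewrite -sa.
  rewrite big_ord_recl expr0 mulr1 addrC => /eqP; rewrite -subr_eq -/u => /eqP ->.
  rewrite mulr_suml (reindex_inj rev_ord_inj)/=; apply: eq_bigr => i _.
  rewrite subKn// /bump add1n exprVn -mulrA; congr (_ * _).
  have -> : x ^+ n = x ^+ i.+1 * x ^+ (n - i.+1) by rewrite -exprD subnKC.
  by rewrite mulrA mulVf ?mul1r// expf_neq0.
Qed.

Lemma maximal_vring : vring R /\ T `<=` mideal R.
Proof.
split; first (split=> // x).
  apply: contrapT => /not_orP[nRx nRxV].
  have x0 : x != 0 by apply/eqP => x0; apply: nRx; rewrite x0; exact: subring0.
  have ext y : ~ R y -> exists2 a, polys_over J a & a.[y] = 1.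
    move=> nRy; apply: contrapT => nrel; apply: nRy.
    suff h : adj_ring R y `<=` R by apply: h; exact: adj_ring_gen.
    apply: maxR; [exact: adj_ring_subring|exact: adj_ring_base|].
    by move=> /(ideal_span_adj TR)[a Ja a1]; apply: nrel; exists a.
  have [a Ja ax] := ext _ nRx; have [b Jb bx] := ext _ nRxV.
  exact: (maximal_no_relations x0 (leqnn _) Ja Jb ax bx).
move=> t Tt; have [->|t0] := eqVneq t 0; [by left|right=> RtV].
apply: properR; rewrite -(divff t0); apply: (ideal_span_mul rR) => //.
exact: (ideal_span_gen rR).
Qed.

End Maximal.

(** Chevalley's existence theorem. Among the rings containing [R0] in which [T]
    generates a proper ideal, Zorn's lemma provides a maximal one. *)
Lemma vring_exists (R0 : set K) : subring R0 -> T `<=` R0 ->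
  ~ ideal_span T R0 1 ->
  exists A, [/\ vring A, R0 `<=` A & T `<=` mideal A].
Proof.
move=> rR0 TR0 proper0.
pose P (R : set K) := [/\ subring R, R0 `<=` R & ~ ideal_span T R 1].
(* The empty set is admitted as the union of the empty chain. *)
have [F FP totF|A [PA maxA]] := Zorn_bigcup (P := fun R => R = set0 \/ P R).
  have [F0|/existsNP[R1 /not_implyP[FR1 R10]]] := pselect (forall R, F R -> R = set0).
    by left; apply/seteqP; split=> // x [R /F0 ->].
  have PF R : F R -> R <> set0 -> P R by move=> /FP[].
  have dir R S : F R -> F S -> exists U, [/\ F U, R `<=` U & S `<=` U].
    by move=> FR FS; have [RS|SR] := totF _ _ FR FS; [exists S|exists R]; split.
  have PR1 := PF _ FR1 R10.
  have dirP R S : F R -> F S -> exists U, [/\ F U, R `<=` U, S `<=` U & P U].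
    move=> FR FS; have [U [FU RU SU]] := dir _ _ FR FS.
    have [V [FV UV R1V]] := dir _ _ FU FR1.
    exists V; split=> //; [exact: subset_trans RU UV|exact: subset_trans SU UV|].
    apply: PF => // V0; apply: R10; apply/seteqP; split=> //.
    by rewrite -V0.
  right; split.
  - split; first by exists R1 => //; case: PR1 => r1 _ _; exact: subring1.
      move=> x y [R FR Rx] [S FS Sy]; have [U [FU RU SU [rU _ _]]] := dirP _ _ FR FS.
      by exists U => //; apply: subringB => //; [exact: RU|exact: SU].
    move=> x y [R FR Rx] [S FS Sy]; have [U [FU RU SU [rU _ _]]] := dirP _ _ FR FS.
    by exists U => //; apply: subringM => //; [exact: RU|exact: SU].
  - by move=> x R0x; exists R1 => //; case: PR1 => _ h _; exact: h.
  suff fin x : ideal_span T (\bigcup_(R in F) R) x ->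
      exists R, [/\ F R, P R & ideal_span T R x].
    by move=> /fin[R [_ [_ _ +]]].
  elim=> [|t r y Tt [S FS Sr] _ [R [FR PR Ry]]]; first by exists R1; split => //; exact: IdealSpan0.
  have [U [FU RU SU PU]] := dirP _ _ FR FS; exists U; split=> //.
  by apply: IdealSpanD => //; [exact: SU|exact: ideal_spanS Ry].
have {PA}[rA R0A properA] : P A.
  case: PA => // A0; exfalso; apply: (maxA R0); last by right; split.
  split; first by rewrite A0; exact: sub0set.
  by move=> /(_ 1 (subring1 rR0)); rewrite A0.
have TA := subset_trans TR0 R0A.
have [|vA TmA] := maximal_vring rA TA properA; last by exists A.
move=> R rR AR properR; apply: contrapT => nRA.
by apply: (maxA R) => //; right; split=> //; exact: subset_trans R0A AR.
Qed.

End Chevalley.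

(** As an intersection of valuation rings, the integral closure is obviously a
    ring and a closure operator; [integral_monic_root] recovers the usual
    description by monic equations. *)
Definition integral_closure (K : fieldType) (B : set K) : set K :=
  [set x | forall A, vring A -> B `<=` A -> A x].

Section IntegralClosure.
Variables (K : fieldType) (B : set K).
Hypothesis rB : subring B.

Lemma integral_closure_subring : subring (integral_closure B).
Proof.
split=> [A [rA _] _|x y Bx By A vA BA|x y Bx By A vA BA].
- exact: subring1.
- by apply: (subringB vA.1); [exact: Bx|exact: By].
- by apply: (subringM vA.1); [exact: Bx|exact: By].
Qed.

Lemma sub_integral_closure : B `<=` integral_closure B.
Proof. by move=> x Bx A _; apply. Qed.

Lemma integral_closure_trans (C : set K) :
  C `<=` integral_closure B -> integral_closure C `<=` integral_closure B.
Proof. by move=> CB x Cx A vA BA; apply: Cx => // y /CB; apply. Qed.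

(** The inverse of [x] generates a proper ideal of B[1/x]. *)
Lemma vring_omit x : ~ adj_ring B x^-1 x ->
  exists A, [/\ vring A, adj_ring B x^-1 `<=` A & ~ A x].
Proof.
move=> nBx; have rBx := adj_ring_subring x^-1 rB.
have x0 : x != 0 by apply/eqP => x0; apply: nBx; rewrite {2}x0; exact: subring0.
have [||] := @vring_exists K [set x^-1] _ rBx.
- by move=> _ ->; exact: adj_ring_gen.
- have sub : ideal_span [set x^-1] (adj_ring B x^-1) `<=`
      [set z | exists2 r, adj_ring B x^-1 r & z = x^-1 * r].
    apply: ideal_span_sub => [|_ _ [r Br ->] [s Bs ->]|_ r -> Br].
    + by exists 0; [exact: subring0|rewrite mulr0].
    + by exists (r + s); [exact: subringD|rewrite mulrDr].
    + by exists r.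
  move=> /sub[r Br e]; apply: nBx.
  by rewrite -[in X in adj_ring _ _ X](mulr1 x) e mulVKf.
move=> A [vA BA mA]; exists A; split=> //.
have : mideal A x^-1 by exact: mA.
by case=> [/eqP|]; [rewrite invr_eq0 (negPf x0)|rewrite invrK].
Qed.

(** By [vring_omit], [x] is a polynomial in 1/x over [B]; clearing denominators
    gives the monic equation. *)
Lemma integral_monic_root x : integral_closure B x ->
  exists q : {poly K}, [/\ q \is monic, polys_over B q & root q x].
Proof.
move=> Bx; have [->|x0] := eqVneq x 0.
  exists 'X; split; [exact: monicX|exact: polys_overX|by rewrite rootE hornerX].
have [p Bp px] : adj_ring B x^-1 x.
  apply: contrapT => /vring_omit[A [vA BA]]; apply; apply: Bx => //.
  by apply: subset_trans BA; exact: adj_ring_base.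
pose n := size p; exists ('X^(n.+1) - \poly_(i < n.+1) p`_(n - i)); split.
- by rewrite monicE lead_coefDl ?lead_coefXn// size_polyXn size_polyN ltnS size_poly.
- apply: (subringB (polys_over_subring rB)); first exact: polys_overXn.
  by apply: polys_over_poly => //= i _; exact: Bp.
- rewrite rootE !hornerE horner_poly subr_eq0; apply/eqP.
  rewrite exprS -{1}px (@horner_coef_wide _ n.+1) ?leqnSn// mulr_suml.
  rewrite (reindex_inj rev_ord_inj)/=; apply: eq_bigr => i _.
  rewrite subSS -mulrA; congr (_ * _).
  have le_in : (i <= n)%N by rewrite -ltnS.
  have -> : x ^+ n = x ^+ i * x ^+ (n - i) by rewrite -exprD subnKC.
  by rewrite exprVn; field; rewrite expf_neq0.
Qed.

End IntegralClosure.

(** * Transcendence and Noether normalization *)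

Definition transcendental (K : fieldType) (B : set K) (y : K) : Prop :=
  forall p, polys_over B p -> p.[y] = 0 -> p = 0.

Section AdjSeq.
Variables (K : fieldType) (B0 : set K).

(** The ring B0[y1, ..., yn], built as a tower whose top variable is the head
    of the list. *)
Fixpoint adj_seq (ys : seq K) : set K :=
  if ys is y :: ys' then adj_ring (adj_seq ys') y else B0.

Fixpoint alg_indep (ys : seq K) : Prop :=
  if ys is y :: ys' then transcendental (adj_seq ys') y /\ alg_indep ys'
  else True.

Hypothesis rB0 : subring B0.

Lemma adj_seq_subring ys : subring (adj_seq ys).
Proof. by elim: ys => //= y ys; exact: adj_ring_subring. Qed.

Lemma adj_seq_base ys : B0 `<=` adj_seq ys.
Proof.
elim: ys => //= y ys /subset_trans; apply.
exact/adj_ring_base/adj_seq_subring.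
Qed.

Lemma adj_seq_gen ys y : y \in ys -> adj_seq ys y.
Proof.
elim: ys => //= z ys IH; rewrite inE => /predU1P[->|/IH yys].
  exact/adj_ring_gen/adj_seq_subring.
by apply: adj_ring_base => //; exact: adj_seq_subring.
Qed.

Lemma adj_seq_min C ys : subring C -> B0 `<=` C ->
  (forall y, y \in ys -> C y) -> adj_seq ys `<=` C.
Proof.
move=> rC BC; elim: ys => //= y ys IH ysC.
apply: adj_ring_min => //; last by apply: ysC; rewrite mem_head.
by apply: IH => z zys; apply: ysC; rewrite inE zys orbT.
Qed.

(** Nagata's change of variables: subtracting from each variable a power of
    [x], with exponents that grow quickly enough, makes a single monomial
    dominate. The recursion treats [p] as a polynomial in its first variable,
    whose exponent is chosen after all others. *)
Lemma nagata_change x ys p : polys_over (adj_seq ys) p -> p != 0 ->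
  exists zs, [/\ size zs = size ys,
    forall y, y \in ys -> adj_seq (x :: zs) y,
    forall z, z \in zs -> adj_seq (x :: ys) z &
    exists Q, [/\ polys_over (adj_seq zs) Q, Q != 0, B0 (lead_coef Q)
                & Q.[x] = p.[x]]].
Proof.
elim: ys p => [|y ys IH] p /=.
  by move=> Bp p0; exists [::]; split=> //; exists p; split=> //; exact: Bp.
move=> Bp p0; have rys := adj_seq_subring ys.
have /choice[beta betaP] : forall j, exists b : {poly K},
    polys_over (adj_seq ys) b /\ b.[y] = p`_j.
  by move=> j; have [b Bb bj] := Bp j; exists b.
pose n := size p; pose M := \max_(j < n) size (beta j).
pose gamma a := \poly_(j < n) (beta j)`_a.
have Bgamma a : polys_over (adj_seq ys) (gamma a).
  by apply: polys_over_poly => // j _; exact: (betaP j).1.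
have gammaM a : gamma a != 0 -> (a < M)%N.
  apply: contra_neqT; rewrite -leqNgt => leMa; apply/polyP => j.
  rewrite coef_poly coef0; case: ifP => // ltjn; apply: nth_default.
  by apply: leq_trans leMa; exact: (leq_bigmax (Ordinal ltjn)).
have pxM : p.[x] = \sum_(a < M) (gamma a).[x] * y ^+ a.
  rewrite horner_coef.
  under [RHS]eq_bigr => a _ do rewrite horner_poly mulr_suml.
  rewrite exchange_big/=; apply: eq_bigr => j _.
  rewrite -(betaP j).2 (@horner_coef_wide _ M); last exact: (leq_bigmax j).
  by rewrite mulr_suml; apply: eq_bigr => a _; rewrite mulrAC.
have exg : exists a, gamma a != 0.
  apply: contrapT => /forallNP g0; move/negP: p0; apply; apply/eqP/polyP => j.
  rewrite coef0; have [lenj|ltjn] := leqP n j; first exact: nth_default.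
  rewrite -(betaP j).2 (_ : beta j = 0) ?horner0//; apply/polyP => a.
  have /negP := g0 a; rewrite negbK => /eqP/(congr1 (fun q : {poly K} => q`_j)).
  by rewrite coef_poly ltjn !coef0.
case: (ex_maxnP exg (fun a ga => ltnW (gammaM a ga))) => m gm0 maxm.
have {pxM}px : p.[x] = \sum_(a < m.+1) (gamma a).[x] * y ^+ a.
  rewrite pxM (@big_ord_widen _ _ _ m.+1 M (fun a => (gamma a).[x] * y ^+ a)) ?gammaM//.
  rewrite [RHS]big_mkcond/=; apply: eq_bigr => a _; case: ifPn => //.
  rewrite -leqNgt => ltma; have [->|ga] := eqVneq (gamma a) 0.
    by rewrite horner0 mul0r.
  by have := maxm _ ga; rewrite leqNgt ltma.
have [zs [szs yszs zsys [Q0 [BQ0 Q0n0 lQ0 Q0x]]]] := IH _ (Bgamma m) gm0.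
have rzs := adj_seq_subring zs; have rxzs := adj_seq_subring (x :: zs).
have ys_sub : adj_seq ys `<=` adj_seq (x :: zs).
  by apply: adj_seq_min => //; exact: adj_seq_base.
have /choice[G GP] : forall a, exists g : {poly K},
    polys_over (adj_seq zs) g /\ g.[x] = (gamma a).[x].
  move=> a; have [g Bg gx] : adj_seq (x :: zs) (gamma a).[x]; last by exists g.
  by apply: horner_closed (Bgamma a) => //; apply: adj_seq_gen; rewrite mem_head.
pose e := (\max_(a < m) size (G a)).+1.
pose z := y - x ^+ e; pose Y : {poly K} := 'X^e + z%:P.
have Ym : Y \is monic.
  rewrite monicE lead_coefDl ?lead_coefXn// size_polyXn.
  by apply: leq_ltn_trans (size_polyC_leq1 _) _.
have sY : size Y = e.+1.
  by rewrite size_polyDl size_polyXn// (leq_ltn_trans (size_polyC_leq1 _)).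
have Yx : Y.[x] = y by rewrite /Y hornerD hornerXn hornerC /z addrC subrK.
have sYX a : size (Y ^+ a) = (e * a).+1.
  by rewrite -[LHS]prednK ?lt0n ?size_poly_eq0 ?monic_neq0 ?monic_exp// size_exp sY.
have sub_z : adj_seq zs `<=` adj_seq (z :: zs) by exact: adj_ring_base.
have rzzs := adj_seq_subring (z :: zs).
have BY : polys_over (adj_seq (z :: zs)) Y.
  apply: (subringD (polys_over_subring rzzs)); first exact: polys_overXn.
  by apply: polys_overC => //; apply: adj_seq_gen; rewrite mem_head.
have yE : y = x ^+ e + z by rewrite /z addrC subrK.
have zs_sub : adj_seq zs `<=` adj_seq (x :: z :: zs).
  by move=> u zu; apply: adj_ring_base => //; exact: sub_z.
have rxzzs := adj_seq_subring (x :: z :: zs).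
have gx : adj_seq (x :: z :: zs) x by apply: adj_seq_gen; rewrite mem_head.
have gz : adj_seq (x :: z :: zs) z by apply: adj_seq_gen; rewrite !inE eqxx orbT.
have rxyys := adj_seq_subring (x :: y :: ys).
have gx' : adj_seq (x :: y :: ys) x by apply: adj_seq_gen; rewrite mem_head.
have gy' : adj_seq (x :: y :: ys) y by apply: adj_seq_gen; rewrite !inE eqxx orbT.
exists (z :: zs); split; first by rewrite /= szs.
- move=> u; rewrite inE => /predU1P[->|/yszs].
    by rewrite yE; apply: (subringD rxzzs) => //; exact: (subringX rxzzs).
  exact: adj_ring_min.
- move=> u; rewrite inE => /predU1P[->|/zsys].
    by apply: (subringB rxyys) => //; exact: (subringX rxyys).
  apply: adj_ring_min => //.
  by move=> v yv; apply: adj_ring_base; [exact: (adj_seq_subring (y :: ys))|exact: adj_ring_base].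
pose S := \sum_(a < m) G a * Y ^+ a; pose L := Q0 * Y ^+ m.
have ltSL : (size S < size L)%N.
  have -> : size L = (size Q0 + e * m)%N.
    by rewrite size_Mmonic// ?monic_exp// sYX addnS.
  apply: (@leq_ltn_trans (e * m)); last by rewrite -addn1 addnC leq_add2r lt0n size_poly_eq0.
  apply: (leq_trans (size_sum _ _ _)); apply/bigmax_leqP => a _.
  apply: (leq_trans (size_polyMleq _ _)); rewrite sYX addnS/=.
  apply: (@leq_trans (e + e * a)); last by rewrite -mulnS leq_mul2l ltn_ord orbT.
  by rewrite leq_add2r; apply/ltnW; rewrite ltnS; exact: (leq_bigmax a).
have lL : lead_coef (L + S) = lead_coef Q0.
  by rewrite lead_coefDl// lead_coef_Mmonic// monic_exp.
exists (L + S); split.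
- apply: (subringD (polys_over_subring rzzs)).
    apply: (subringM (polys_over_subring rzzs)); first exact: polys_overS BQ0.
    exact: (subringX (polys_over_subring rzzs)).
  apply: (subring_sum_ord (polys_over_subring rzzs)) => a.
  apply: (subringM (polys_over_subring rzzs)).
    exact: (polys_overS sub_z (GP a).1).
  exact: (subringX (polys_over_subring rzzs)).
- by rewrite -lead_coef_eq0 lL lead_coef_eq0.
- by rewrite lL.
rewrite px big_ord_recr/= hornerD hornerM horner_exp Yx Q0x addrC horner_sum.
by congr (_ + _); apply: eq_bigr => a _; rewrite hornerM horner_exp Yx (GP a).2.
Qed.

(** Either the head of the list is transcendental over the ring obtained from
    the tail, or a change of variables makes the whole list integral over fewer
    elements. *)
Lemma noether_normalization xs : (forall b, B0 b -> B0 b^-1) ->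
  exists ys, [/\ alg_indep ys, (size ys <= size xs)%N,
    forall y, y \in ys -> adj_seq xs y &
    forall x, x \in xs -> integral_closure (adj_seq ys) x].
Proof.
move=> B0V; have [n] := ubnP (size xs); elim: n xs => // n IH [|x xs] /=.
  by move=> _; exists [::]; split.
rewrite ltnS => sxs; have [ys [iys sys ysxs xsys]] := IH xs sxs.
have rys := adj_seq_subring ys; have rxxs := adj_seq_subring (x :: xs).
have rxys := adj_seq_subring (x :: ys).
have xs_sub : adj_seq xs `<=` adj_seq (x :: xs).
  by apply: adj_ring_base; exact: adj_seq_subring.
have [tx|] := pselect (transcendental (adj_seq ys) x).
  exists (x :: ys); split=> //.
    move=> y; rewrite inE => /predU1P[->|/ysxs/xs_sub//].
    exact: (adj_seq_gen (ys := x :: xs) (mem_head _ _)).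
  move=> y; rewrite inE => /predU1P[->|/xsys].
    by apply: sub_integral_closure; exact: (adj_seq_gen (ys := x :: ys) (mem_head _ _)).
  apply: integral_closure_trans => //; apply: subset_trans (@sub_integral_closure _ _).
  exact: adj_ring_base.
move=> /existsNP[p /not_implyP[Bp /not_implyP[px /eqP p0]]].
have [zs [szs yszs zsys [Q [BQ Q0 lQ Qx]]]] := nagata_change x Bp p0.
have [|us [ius sus uszs zsus]] := IH zs; first by rewrite szs; exact: leq_ltn_trans sxs.
have ric := integral_closure_subring (adj_seq us).
have zs_ic : adj_seq zs `<=` integral_closure (adj_seq us).
  apply: adj_seq_min => //; apply: subset_trans (@sub_integral_closure _ _).
  exact: adj_seq_base.
have x_ic : integral_closure (adj_seq us) x.
  apply: (integral_closure_trans zs_ic) => A vA zsA.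
  apply: (vring_root vA (polys_overS zsA BQ) Q0).
    by apply/zsA/adj_seq_base/B0V.
  by rewrite rootE Qx px.
have ys_ic : adj_seq ys `<=` integral_closure (adj_seq us).
  apply: adj_seq_min => //.
    by apply: subset_trans (@sub_integral_closure _ _); exact: adj_seq_base.
  by move=> y /yszs; exact: adj_ring_min.
exists us; split=> //.
- by apply: leq_trans sus _; rewrite szs; exact: leqW.
- move=> u /uszs; apply: adj_seq_min => //; first exact: (adj_seq_base (x :: xs)).
  move=> z /zsys; apply: adj_ring_min => //; last exact: (adj_seq_gen (ys := x :: xs) (mem_head _ _)).
  by apply: adj_seq_min => //; [exact: (adj_seq_base (x :: xs))|move=> y /ysxs/xs_sub].
- move=> y; rewrite inE => /predU1P[->//|/xsys].
  exact: integral_closure_trans.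
Qed.

End AdjSeq.

(** The reversed polynomial annihilates [y]. *)
Lemma transcendental_inv (K : fieldType) (B : set K) y :
  subring B -> transcendental B y -> transcendental B y^-1.
Proof.
move=> rB ty p Bp py; have [//|p0] := eqVneq p 0; exfalso.
have y0 : y != 0.
  apply/eqP => y0; have : 'X = 0 :> {poly K}.
    by apply: ty; [exact: polys_overX|rewrite hornerX].
  by move/eqP; rewrite polyX_eq0.
pose n := (size p).-1.
have sp : size p = n.+1 by rewrite prednK// lt0n size_poly_eq0.
have : \poly_(i < n.+1) p`_(n - i) = 0.
  apply: ty; first by apply: polys_over_poly => // i _; exact: Bp.
  apply: (etrans (y := y ^+ n * p.[y^-1])); last by rewrite py mulr0.
  rewrite horner_poly horner_coef sp mulr_sumr.
  rewrite (reindex_inj rev_ord_inj)/=; apply: eq_bigr => i _.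
  have le_in : (i <= n)%N by rewrite -ltnS.
  rewrite subSS subKn//.
  have -> : y ^+ n = y ^+ i * y ^+ (n - i) by rewrite -exprD subnKC.
  by rewrite exprVn; field; rewrite expf_neq0.
move=> /(congr1 (fun q : {poly K} => q`_0)).
rewrite coef_poly coef0/= subn0 => /eqP.
by rewrite -[n]/(n.+1.-1) -sp -lead_coefE lead_coef_eq0 (negPf p0).
Qed.

Definition fractions (K : fieldType) (B : set K) : set K :=
  [set x | exists a b, [/\ B a, B b, b != 0 & x = a / b]].

Section Fractions.
Variables (K : fieldType) (B : set K).
Hypothesis rB : subring B.

Lemma fractions_base : B `<=` fractions B.
Proof.
move=> x Bx; exists x, 1; split; [by []|exact: subring1|exact: oner_neq0|by rewrite divr1].
Qed.

Lemma fractions_subring : subring (fractions B).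
Proof.
split=> [|_ _ [a [b [Ba Bb b0 ->]]] [c [e [Bc Be e0 ->]]]
        |_ _ [a [b [Ba Bb b0 ->]]] [c [e [Bc Be e0 ->]]]].
- exact: (fractions_base (subring1 rB)).
- exists (a * e - c * b), (b * e); split; [|exact: subringM|exact: mulf_neq0|].
    by apply: subringB => //; exact: subringM.
  by field; rewrite b0 e0.
- exists (a * c), (b * e); split; [exact: subringM|exact: subringM|exact: mulf_neq0|].
  by field; rewrite b0 e0.
Qed.

Lemma fractions_inv x : fractions B x -> fractions B x^-1.
Proof.
move=> [a [b [Ba Bb b0 ->]]]; have [->|a0] := eqVneq a 0.
  by rewrite mul0r invr0; exact: (fractions_base (subring0 rB)).
by exists b, a; split => //; rewrite invf_div.
Qed.

Lemma common_denominator p : polys_over (fractions B) p ->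
  exists b, [/\ B b, b != 0 & polys_over B (b *: p)].
Proof.
elim/poly_ind: p => [|p c IH] Fp.
  exists 1; split; [exact: subring1|exact: oner_neq0|].
  by move=> i; rewrite scaler0 coef0; exact: subring0.
have [b [Bb b0 Bbp]] : exists b, [/\ B b, b != 0 & polys_over B (b *: p)].
  by apply: IH => i; have := Fp i.+1; rewrite coefD coefC coefMX addr0.
have := Fp 0%N; rewrite coefD coefC coefMX add0r => -[a [e [Ba Be e0 /= ca]]].
exists (b * e); split; [exact: subringM|exact: mulf_neq0|].
move=> [|i]; rewrite coefZ coefD coefC coefMX/=.
  have -> : b * e * (0 + c) = b * a by rewrite ca; field.
  exact: subringM.
have -> : b * e * (p`_i + 0) = e * (b *: p)`_i by rewrite coefZ; ring.
exact: (subringM rB).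
Qed.

Lemma transcendental_fractions y :
  transcendental B y -> transcendental (fractions B) y.
Proof.
move=> ty p Fp py; have [b [Bb b0 Bbp]] := common_denominator Fp.
apply/eqP; rewrite -[_ == _]orFb -(negPf b0) -scaler_eq0; apply/eqP.
by apply: ty => //; rewrite hornerZ py mulr0.
Qed.

End Fractions.

(** * Integrally closed rings and polynomials *)

Section VRingPoly.
Variables (K : fieldType) (A : set K).
Hypothesis vA : vring A.
Let rA := vring_subring vA.
Let rAX := polys_over_subring rA.

(** The scalar [e] is a coefficient of [p] of least valuation. *)
Lemma vring_content p : p != 0 ->
  exists e (p1 : {poly K}),
    [/\ e != 0, p = e *: p1, polys_over A p1 & exists i, p1`_i = 1].
Proof.
move=> p0; suff [e [e0 [i pi] Ap]] : exists e,
    [/\ e != 0, exists i, p`_i = e & forall j, A (p`_j / e)].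
  exists e, (e^-1 *: p); split=> //; first by rewrite scalerA mulfV// scale1r.
    by move=> j; rewrite coefZ mulrC; exact: Ap.
  by exists i; rewrite coefZ pi mulVf.
elim/poly_ind: p p0 => [|p c IH]; first by rewrite eqxx.
have coefS j : (p * 'X + c%:P)`_j = if j is i.+1 then p`_i else c.
  by rewrite coefD coefMX coefC; case: j => [|j] /=; rewrite ?add0r ?addr0.
have [->|p0 _] := eqVneq p 0.
  rewrite mul0r add0r polyC_eq0 => c0; exists c; split=> //.
    by exists 0%N; rewrite coefC.
  move=> j; rewrite coefC; case: eqP => _; last by rewrite mul0r; exact: subring0.
  by rewrite divff//; exact: subring1.
have [e [e0 [i pi] Ap]] := IH p0.
have [Ace|nAce] := pselect (A (c / e)).
  exists e; split=> //; first by exists i.+1; rewrite coefS.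
  by case=> [|j]; rewrite coefS.
have c0 : c != 0.
  by apply/eqP => c0; apply: nAce; rewrite c0 mul0r; exact: subring0.
have Aec : A (e / c) by case: (vA.2 (c / e)) => //; rewrite invf_div.
exists c; split=> //; first by exists 0%N; rewrite coefS.
case=> [|j]; rewrite coefS; first by rewrite divff//; exact: subring1.
have -> : p`_j / c = p`_j / e * (e / c) by field; rewrite e0 c0.
exact: (subringM rA (Ap j) Aec).
Qed.

(** Gauss's lemma: the first coefficients outside the maximal ideal multiply to
    a coefficient of the product outside it. *)
Lemma mideal_poly_prime p q : polys_over A p -> polys_over A q ->
  polys_over (mideal A) (p * q) ->
  polys_over (mideal A) p \/ polys_over (mideal A) q.
Proof.
move=> Ap Aq mpq; apply: contrapT => /not_orP[/existsNP exp /existsNP exq].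
have first (r : {poly K}) : (exists i, ~ mideal A r`_i) ->
    exists i, ~ mideal A r`_i /\ forall j, (j < i)%N -> mideal A r`_j.
  move=> exr; have exr' : exists i, ~~ `[< mideal A r`_i >].
    by case: exr => i ri; exists i; apply/asboolPn.
  case: (ex_minnP exr') => i /asboolPn ri mini; exists i; split=> // j ltji.
  by apply: contrapT => /asboolPn /mini; rewrite leqNgt ltji.
have [i [npi mp]] := first _ exp; have [j [nqj mq]] := first _ exq.
have := mpq (i + j)%N; rewrite coefM.
have ltij : (i < (i + j).+1)%N by rewrite ltnS leq_addr.
rewrite (bigD1 (Ordinal ltij))//= addKn => msum.
suff : mideal A (p`_i * q`_j) by case/(mideal_prime vA (Ap _) (Aq _)).
rewrite -(addrK (\sum_(l < (i + j).+1 | l != Ordinal ltij) p`_l * q`_(i + j - l))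
  (p`_i * q`_j)); apply: midealD => //; apply: midealN => //.
elim/big_ind: _ => [|u v mu mv|l neli]; [exact: mideal0|exact: midealD|].
have [ltli|leil] := ltnP l i; first by apply: midealM => //; exact: mp.
apply: midealMl => //; apply: mq; rewrite ltn_subLR; last by rewrite -ltnS.
rewrite ltn_add2r ltn_neqAle leil andbT; apply: contra neli => /eqP e.
exact/eqP/val_inj.
Qed.

Lemma mideal_poly_pow p n : polys_over A p ->
  polys_over (mideal A) (p ^+ n) -> polys_over (mideal A) p.
Proof.
move=> Ap; elim: n => [|n IHn].
  by rewrite expr0 => /(_ 0%N); rewrite coef1 => /mideal1 [].
rewrite exprS => /(mideal_poly_prime Ap); case=> //.
exact: (subringX rAX).
Qed.

(** The contents of [p] and [q] have inverses in [A] because [p] and [q] are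
    monic, and their product is in [A] because the product of the primitive
    parts has a coefficient that is a unit. *)
Lemma gauss_monic p q : p \is monic -> q \is monic ->
  polys_over A (p * q) -> polys_over A p.
Proof.
move=> pm qm Apq.
have [e [p1 [e0 pE Ap1 [i p1i]]]] := vring_content (monic_neq0 pm).
have [f [q1 [f0 qE Aq1 [j q1j]]]] := vring_content (monic_neq0 qm).
have [l npq1] : exists l, ~ mideal A (p1 * q1)`_l.
  apply/existsNP => /(mideal_poly_prime Ap1 Aq1)[/(_ i)|/(_ j)].
    by rewrite p1i => /mideal1 [].
  by rewrite q1j => /mideal1 [].
have Af : A f^-1.
  have : lead_coef q = f * lead_coef q1 by rewrite qE lead_coefZ.
  rewrite (monicP qm) => /(congr1 ( *%R f^-1)); rewrite mulr1 mulKf// => ->.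
  exact: Aq1.
have A1 : A (p1 * q1)`_l by exact: (subringM rAX).
have pql0 : (p1 * q1)`_l != 0 by apply/eqP => z; apply: npq1; left.
suff Ae : A e by rewrite pE; exact: polys_overZ.
have -> : e = (p * q)`_l / (p1 * q1)`_l * f^-1.
  rewrite pE qE -scalerAl -scalerAr !coefZ; field.
  by rewrite f0 pql0.
apply: (subringM rA) => //; apply: (subringM rA) => //.
exact: midealV.
Qed.

(** If the content [e] of [U] were not in [A], dividing the equation by the n-th
    power of [e] would put a power of the primitive part of [U] in the maximal
    ideal. *)
Lemma vring_poly_integral n (a : nat -> {poly K}) U :
  (forall i, (i < n)%N -> polys_over A (a i)) ->
  U ^+ n = - \sum_(i < n) a i * U ^+ i -> polys_over A U.
Proof.
move=> Aa eqU; have [->|U0] := eqVneq U 0.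
  by move=> i; rewrite coef0; exact: subring0.
have [e [U1 [e0 UE AU1 [j U1j]]]] := vring_content U0.
have [Ae|/vring_notin me] := pselect (A e).
  by rewrite UE; exact: polys_overZ.
exfalso; apply: (@mideal1 K A vA); rewrite -U1j; move: j {U1j}.
apply: (@mideal_poly_pow _ n) => //.
have -> : U1 ^+ n = - \sum_(i < n) (e^-1 ^+ (n - i)) *: (a i * U1 ^+ i).
  have e0n : e ^+ n != 0 by rewrite expf_neq0.
  apply: (scalerI e0n); rewrite -exprZn -UE eqU scalerN scaler_sumr.
  congr (- _); apply: eq_bigr => i _; rewrite {1}UE exprZn scalerA -scalerAr.
  have -> : e ^+ n = e ^+ (n - i) * e ^+ i by rewrite -exprD subnK// ltnW.
  by congr (_ *: _); rewrite exprVn; field; rewrite expf_neq0.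
move=> l; rewrite coefN coef_sum; apply: midealN => //.
apply: mideal_sum_ord => // i; rewrite coefZ; apply: midealM => //.
  rewrite -(@prednK (n - i)) ?subn_gt0// exprS; apply: midealM => //.
  by apply: (subringX rA); exact: mideal_sub.
by apply: (subringM rAX); [exact: Aa|exact: (subringX rAX)].
Qed.

End VRingPoly.

Lemma pseudo_division (K : fieldType) (B : set K) (F G : {poly K}) :
  subring B -> polys_over B F -> polys_over B G -> G != 0 ->
  exists c (H R : {poly K}), [/\ B c, c != 0, polys_over B H, polys_over B R &
    c *: F = H * G + R /\ (size R < size G)%N].
Proof.
move=> rB; have rBX := polys_over_subring rB => + BG G0.
have [n] := ubnP (size F); elim: n F => // n IH F; rewrite ltnS => sF BF.
have [ltFG|leGF] := ltnP (size F) (size G).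
  exists 1, 0, F; split; [exact: subring1|exact: oner_neq0|exact: subring0|by []|].
  by rewrite scale1r mul0r add0r.
have sG : (0 < size G)%N by rewrite lt0n size_poly_eq0.
pose g := lead_coef G; pose M : {poly K} := lead_coef F *: 'X^(size F - size G).
have g0 : g != 0 by rewrite lead_coef_eq0.
have Bg : B g by exact: BG.
have BM : polys_over B M by apply: polys_overZ => //; [exact: BF|exact: polys_overXn].
have [||c [H [R [Bc c0 BH BR [E sR]]]]] := IH (g *: F - M * G).
- have sF0 : (0 < size F)%N by exact: leq_trans leGF.
  apply: leq_trans sF; rewrite -(prednK sF0) ltnS.
  apply/leq_sizeP => j; rewrite leq_eqVlt => /predU1P[<-|ltFj].
    rewrite coefB coefZ -scalerAl coefZ coefXnM.
    have -> : ((size F).-1 < size F - size G)%N = false.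
      by apply/negbTE; rewrite -leqNgt -subn1 leq_sub2l.
    have -> : ((size F).-1 - (size F - size G) = (size G).-1)%N.
      by rewrite -subn1 subnAC subKn// subn1.
    by rewrite -!lead_coefE mulrC subrr.
  have leFj : (size F <= j)%N by rewrite -(prednK sF0).
  rewrite coefB coefZ (nth_default _ leFj) mulr0 sub0r nth_default ?oppr0//.
  rewrite -scalerAl; apply: leq_trans leFj; apply: (leq_trans (size_scale_leq _ _)).
  apply: (leq_trans (size_polyMleq _ _)); rewrite size_polyXn addSn/=.
  by rewrite subnK.
- by apply: (subringB rBX); [exact: polys_overZ|exact: (subringM rBX)].
exists (c * g), (H + c *: M), R; split => //.
- exact: subringM.
- exact: mulf_neq0.
- by apply: (subringD rBX) => //; exact: polys_overZ.
split=> //; rewrite mulrDl addrAC -E -scalerA scalerBr.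
by rewrite -[(c *: M) * G]scalerAl subrK.
Qed.

Definition integrally_closed (K : fieldType) (B : set K) : Prop :=
  forall x, fractions B x -> integral_closure B x -> B x.

(** The rational root theorem in K[X]: once the common factors are removed, [G]
    divides a power of [F]. *)
Lemma dvdp_of_integral (K : fieldType) n (a : nat -> {poly K}) (F G : {poly K}) :
  G != 0 -> F ^+ n = - \sum_(i < n) a i * F ^+ i * G ^+ (n - i) -> G %| F.
Proof.
move=> G0 E; pose D := gcdp F G.
have D0 : D != 0 by rewrite gcdp_eq0 negb_and G0 orbT.
have FE : F = F %/ D * D by rewrite divpK// dvdp_gcdl.
have GE : G = G %/ D * D by rewrite divpK// dvdp_gcdr.
set F' := F %/ D in FE *; set G' := G %/ D in GE *.
have cop : coprimep G' F' by rewrite coprimep_sym; apply: coprimep_div_gcd; rewrite G0 orbT.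
have E' : F' ^+ n = - \sum_(i < n) a i * F' ^+ i * G' ^+ (n - i).
  have Dn0 : D ^+ n != 0 by rewrite expf_neq0.
  apply: (mulIf Dn0); rewrite -exprMn -FE E mulNr mulr_suml.
  congr (- _); apply: eq_bigr => i _; rewrite {1}FE {1}GE !exprMn.
  have -> : D ^+ n = D ^+ i * D ^+ (n - i) by rewrite -exprD subnKC// ltnW.
  by ring.
have dv : G' %| F' ^+ n.
  rewrite E' dvdpNr; elim/big_ind: _ => [||i _]; [exact: dvdp0|exact: dvdp_add|].
  apply: dvdp_mull; rewrite -(@prednK (n - i)) ?subn_gt0// exprS.
  exact: dvdp_mulr.
have : size G' == 1%N.
  by rewrite -coprimepp; exact: coprimep_dvdl dv (coprimep_expr n cop).
rewrite size_poly_eq1 => G1; rewrite FE GE.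
by apply: dvdp_mul => //; rewrite (eqp_dvdl _ G1) dvd1p.
Qed.

(** An integral element x = f / g of the fraction field is first shown to be a
    polynomial U(y), by [dvdp_of_integral] and division with remainder; then the
    coefficients of U belong to each valuation ring containing [B], by
    [vring_poly_integral], hence to [B]. *)
Lemma integrally_closed_adj (K : fieldType) (B : set K) y :
  subring B -> transcendental B y -> integrally_closed B ->
  integrally_closed (adj_ring B y).
Proof.
move=> rB ty nB x [_ [_ [[F BF <-] [G BG <-] g0 xE]]] icx.
have rBX := polys_over_subring rB.
have G0 : G != 0 by apply: contraNneq g0 => ->; rewrite horner0.
have [Q [Qm BQ /rootP Qx]] := integral_monic_root (adj_ring_subring y rB) icx.
pose n := (size Q).-1; have sQ : size Q = n.+1.
  by rewrite prednK// lt0n size_poly_eq0 monic_neq0.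
have /choice[a aP] : forall i, exists a : {poly K}, polys_over B a /\ a.[y] = Q`_i.
  by move=> i; have [a Ba aE] := BQ i; exists a.
have relx : x ^+ n = - \sum_(i < n) Q`_i * x ^+ i.
  move: Qx; rewrite horner_coef sQ big_ord_recr/= -[n in Q`_n]/(n.+1.-1) -sQ.
  by rewrite -lead_coefE (monicP Qm) mul1r addrC => /eqP; rewrite addr_eq0 => /eqP.
(* As y is transcendental, the equation of x lifts from B[y] to B[X]. *)
have lift (f g : {poly K}) : polys_over B f -> polys_over B g ->
    g.[y] * x = f.[y] -> f ^+ n = - \sum_(i < n) a i * f ^+ i * g ^+ (n - i).
  move=> Bf Bg fg; apply/eqP; rewrite -subr_eq0 opprK; apply/eqP; apply: ty.
    apply: (subringD rBX); first exact: (subringX rBX).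
    apply: (subring_sum_ord rBX) => i; apply: (subringM rBX); last exact: (subringX rBX).
    by apply: (subringM rBX); [exact: (aP i).1|exact: (subringX rBX)].
  rewrite hornerD horner_exp horner_sum -fg exprMn relx mulrN mulr_sumr.
  rewrite addrC -sumrB big1// => i _.
  rewrite !hornerM !horner_exp -fg (aP i).2 exprMn.
  have -> : g.[y] ^+ n = g.[y] ^+ i * g.[y] ^+ (n - i) by rewrite -exprD subnKC// ltnW.
  by ring.
have GF : G %| F.
  by apply: (dvdp_of_integral G0 (lift F G BF BG _)); rewrite xE mulrC divfK.
have [c [H [R [Bc c0 BH BR [E sR]]]]] := pseudo_division rB BF BG G0.
have {}R0 : R = 0.
  apply/eqP; apply: contraTT sR => R0; rewrite -leqNgt; apply: dvdp_leq => //.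
  by rewrite -(dvdp_addr _ (dvdp_mull H (dvdpp G))) -E dvdpZr.
have cx : c * x = H.[y].
  move/(congr1 (horner^~ y)): E; rewrite R0 addr0 hornerZ hornerM => E.
  by rewrite xE mulrA E mulfK.
pose U := c^-1 *: H; have Ux : x = U.[y] by rewrite hornerZ -cx mulKf.
have relU : U ^+ n = - \sum_(i < n) a i * U ^+ i.
  have Hn := lift H c%:P BH (polys_overC rB Bc) _.
  rewrite hornerC in Hn; move/(_ cx): Hn => Hn.
  have cn0 : c ^+ n != 0 by rewrite expf_neq0.
  apply: (scalerI cn0); rewrite -exprZn scalerA mulfV// scale1r Hn scalerN scaler_sumr.
  congr (- _); apply: eq_bigr => i _; rewrite exprZn -scalerAr scalerA mulrC.
  rewrite -polyC_exp mul_polyC; congr (_ *: _).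
  have -> : c ^+ n = c ^+ i * c ^+ (n - i) by rewrite -exprD subnKC// ltnW.
  by rewrite exprVn; field; rewrite expf_neq0.
exists U; last by rewrite Ux.
move=> i; apply: nB.
  by exists H`_i, c; split=> //; rewrite coefZ mulrC.
move=> A vA BA; apply: (vring_poly_integral vA _ relU) => j _.
exact: polys_overS (aP j).1.
Qed.

Lemma integrally_closed_adj_seq (K : fieldType) (B0 : set K) ys :
  subring B0 -> (forall b, B0 b -> B0 b^-1) -> alg_indep B0 ys ->
  integrally_closed (adj_seq B0 ys).
Proof.
move=> rB0 B0V; elim: ys => [_|y ys IH [ty iys]].
  by move=> _ [a [b [Ba Bb _ ->]]] _; apply: subringM => //; exact: B0V.
by apply: integrally_closed_adj => //; [exact: adj_seq_subring|exact: IH].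
Qed.

(** A polynomial of least degree that annihilates an integral element becomes,
    once made monic, a factor of a monic polynomial over [P], so that Gauss's
    lemma applies. *)
Lemma min_annihilator_coef (K : fieldType) (P : set K) g q :
  subring P -> integrally_closed P -> integral_closure P g ->
  polys_over P q -> q != 0 -> q.[g] = 0 ->
  (forall s, polys_over P s -> s.[g] = 0 -> s != 0 -> (size q <= size s)%N) ->
  forall i, P (q`_i / lead_coef q).
Proof.
move=> rP nP icg Pq q0 qg minq i.
have b0 : lead_coef q != 0 by rewrite lead_coef_eq0.
have Pb : P (lead_coef q) by exact: Pq.
have [Q [Qm PQ /rootP Qg]] := integral_monic_root rP icg.
have [c [H [R [Pc c0 PH PR [E sR]]]]] := pseudo_division rP PQ Pq q0.
have R0 : R = 0.
  apply/eqP; apply: contraTT sR => R0; rewrite -leqNgt; apply: minq => //.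
  have := congr1 (horner^~ g) E.
  by rewrite hornerZ hornerD hornerM Qg qg !mulr0 add0r => <-.
apply: nP; first by exists q`_i, (lead_coef q).
move=> A vA PA; rewrite mulrC -coefZ; move: i.
have qm : (lead_coef q)^-1 *: q \is monic by rewrite monicE lead_coefZ mulVf.
have Q_E : (lead_coef q)^-1 *: q * ((lead_coef q / c) *: H) = Q.
  apply: (scalerI c0); rewrite E R0 addr0 -scalerAl -scalerAr !scalerA.
  rewrite [H * q]mulrC -[RHS]scale1r; congr (_ *: _); field.
  by rewrite c0 b0.
apply: (gauss_monic vA qm (q := (lead_coef q / c) *: H)).
  rewrite monicE -(monicP Qm) -Q_E lead_coefM.
  by rewrite (monicP qm) mul1r.
by rewrite Q_E; exact: polys_overS PQ.
Qed.

(** * Divisibility by the top variable *)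

(** The element [Y] of B[Y] is prime and does not divide [a], as reducing modulo
    [Y] amounts to taking constant coefficients. *)
Lemma adj_ring_dvd_gen (K : fieldType) (B : set K) Y a c d m :
  subring B -> transcendental B Y -> B a -> a != 0 ->
  adj_ring B Y c -> adj_ring B Y d -> c * a = d * Y ^+ m.+1 ->
  exists2 c', adj_ring B Y c' & c = Y * c'.
Proof.
move=> rB tY Ba a0 [C BC <-] [D BD <-] E; have rBX := polys_over_subring rB.
have /eqP : C * a%:P - D * 'X^(m.+1) = 0.
  apply: tY; last by rewrite hornerD hornerN !hornerM hornerC hornerXn E subrr.
  apply: (subringB rBX); apply: (subringM rBX) => //; first exact: polys_overC.
  exact: polys_overXn.
rewrite subr_eq0 => /eqP/(congr1 (fun p : {poly K} => p`_0)).
rewrite coefMC coefMXn/= => /eqP; rewrite mulf_eq0 (negPf a0) orbF => /eqP C0.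
exists (\poly_(i < size C) C`_i.+1).[Y].
  by exists (\poly_(i < size C) C`_i.+1) => //; apply: polys_over_poly.
have {1}-> : C = \poly_(i < size C) C`_i.+1 * 'X.
  apply/polyP => -[|i]; rewrite coefMX//= coef_poly; case: ltnP => // leCi.
  by rewrite nth_default// leqW.
by rewrite hornerM hornerX mulrC.
Qed.

(** The prime [Y] of B[Y] behaves like a prime in the integral closure: as it
    does not divide [a], it divides a power of [g]. More precisely, the non-leading
    coefficients of the minimal polynomial of [g] over the fraction field are
    divisible by [Y]. Indeed the minimal polynomial of [r] = g a / Y is obtained
    from that of [g] by multiplying the coefficients by powers of a / Y, and both
    polynomials have coefficients in B[Y], by [min_annihilator_coef]. *)
Lemma integral_dvd_gen (K : fieldType) (B : set K) Y a g r :
  subring B -> integrally_closed B -> transcendental B Y ->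
  B a -> a != 0 ->
  integral_closure (adj_ring B Y) g -> integral_closure (adj_ring B Y) r ->
  g * a = Y * r ->
  exists N (c : nat -> K),
    (forall i, (i < N)%N -> exists2 c', adj_ring B Y c' & c i = Y * c') /\
    g ^+ N = - \sum_(i < N) c i * g ^+ i.
Proof.
move=> rB nB tY Ba a0 icg icr E.
set P := adj_ring B Y in icg icr *.
have rP : subring P by exact: adj_ring_subring.
have rPX := polys_over_subring rP.
have nP : integrally_closed P by exact: integrally_closed_adj.
have PY : P Y by exact: adj_ring_gen.
have Pa : P a by exact: adj_ring_base.
have Y0 : Y != 0.
  apply/eqP => Y0; have /eqP : 'X = 0 :> {poly K}.
    by apply: tY; [exact: polys_overX|rewrite hornerX].
  by rewrite polyX_eq0.
(* Denominators are cleared: q stands for the minimal polynomial of g. *)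
pose ann n := `[< exists s : {poly K}, [/\ polys_over P s, s != 0, s.[g] = 0 & size s = n] >].
have exann : exists n, ann n.
  have [Q [Qm PQ /rootP Qg]] := integral_monic_root rP icg.
  by exists (size Q); apply/asboolP; exists Q; split=> //; exact: monic_neq0.
case: (ex_minnP exann) => n /asboolP[q [Pq q0 qg sq]] minn.
have minq s : polys_over P s -> s.[g] = 0 -> s != 0 -> (size q <= size s)%N.
  by move=> Ps sg s0; rewrite sq; apply: minn; apply/asboolP; exists s; split.
have sq_gt0 : (0 < size q)%N by rewrite lt0n size_poly_eq0.
pose N := (size q).-1; have sqN : size q = N.+1 by rewrite prednK.
have lq : lead_coef q = q`_N by rewrite lead_coefE.
have lq0 : q`_N != 0 by rewrite -lq lead_coef_eq0.
(* The minimal polynomial of r, up to a scalar. *)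
pose qr := \poly_(i < N.+1) (q`_i * a ^+ (N - i) * Y ^+ i).
have qrN0 : qr`_N != 0.
  by rewrite coef_poly ltnSn subnn expr0 mulr1 mulf_neq0// expf_neq0.
have sqr : size qr = N.+1 by rewrite size_poly_eq// subnn expr0 mulr1 mulf_neq0// expf_neq0.
have lqr : lead_coef qr = q`_N * Y ^+ N.
  by rewrite lead_coefE sqr/= coef_poly ltnSn subnn expr0 mulr1.
have Pqr : polys_over P qr.
  apply: polys_over_poly => // i _.
  by apply: (subringM rP); [apply: (subringM rP) => //|]; exact: (subringX rP).
have qrr : qr.[r] = 0.
  apply: (etrans (y := a ^+ N * q.[g])); last by rewrite qg mulr0.
  rewrite horner_poly horner_coef sqN mulr_sumr; apply: eq_bigr => i _.
  have le_iN : (i <= N)%N by rewrite -ltnS.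
  rewrite -mulrA -exprMn -E exprMn.
  have -> : a ^+ N = a ^+ (N - i) * a ^+ i by rewrite -exprD subnK.
  by ring.
have minqr s : polys_over P s -> s.[r] = 0 -> s != 0 -> (size qr <= size s)%N.
  move=> Ps sr s0; rewrite sqr -sqN; pose M := (size s).-1.
  have ssM : size s = M.+1 by rewrite prednK// lt0n size_poly_eq0.
  have sM0 : s`_M != 0 by rewrite -lead_coefE lead_coef_eq0.
  pose t := \poly_(i < M.+1) (s`_i * Y ^+ (M - i) * a ^+ i).
  have st : size t = M.+1 by rewrite size_poly_eq// subnn expr0 mulr1 mulf_neq0// expf_neq0.
  rewrite ssM -st; apply: minq.
  - apply: polys_over_poly => // i _.
    by apply: (subringM rP); [apply: (subringM rP) => //|]; exact: (subringX rP).
  - apply: (etrans (y := Y ^+ M * s.[r])); last by rewrite sr mulr0.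
    rewrite horner_poly horner_coef ssM mulr_sumr; apply: eq_bigr => i _.
    have le_iM : (i <= M)%N by rewrite -ltnS.
    rewrite -mulrA -exprMn [a * g]mulrC E exprMn.
    have -> : Y ^+ M = Y ^+ (M - i) * Y ^+ i by rewrite -exprD subnK.
    by ring.
  - by rewrite -size_poly_eq0 st.
have Pc := min_annihilator_coef rP nP icg Pq q0 qg minq.
have Pd := min_annihilator_coef rP nP icr Pqr _ qrr minqr.
exists N, (fun i => q`_i / q`_N); split.
  move=> i ltiN.
  have [m Em] : exists m, (N - i = m.+1)%N by exists (N - i).-1; rewrite prednK// subn_gt0.
  have PdE : P (qr`_i / lead_coef qr) by apply: Pd; rewrite -size_poly_eq0 sqr.
  apply: (adj_ring_dvd_gen rB tY (a := a ^+ (N - i)) (m := m) _ _ _ PdE).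
  - exact: (subringX rB).
  - by rewrite expf_neq0.
  - by have := Pc i; rewrite lq.
  rewrite lqr coef_poly ltnS (ltnW ltiN) -Em.
  have -> : Y ^+ N = Y ^+ (N - i) * Y ^+ i by rewrite -exprD subnK// ltnW.
  by field; rewrite lq0 !expf_neq0.
have : q`_N * (g ^+ N + \sum_(i < N) q`_i / q`_N * g ^+ i) = 0.
  apply: (etrans (y := q.[g])); last exact: qg.
  rewrite horner_coef sqN big_ord_recr/= mulrDr addrC; congr (_ + _).
  by rewrite mulr_sumr; apply: eq_bigr => i _; rewrite mulrA mulrCA mulfV// mulr1.
by move/eqP; rewrite mulf_eq0 (negPf lq0)/= addr_eq0 => /eqP.
Qed.

(** * Transcendence degree *)

Lemma transcendental_inv_notin (K : fieldType) (B : set K) z :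
  subring B -> transcendental B z -> ~ adj_ring B z z^-1.
Proof.
move=> rB tz [p Bp pz]; have rBX := polys_over_subring rB.
have z0 : z != 0.
  apply/eqP => z0; have /eqP : 'X = 0 :> {poly K}.
    by apply: tz; [exact: polys_overX|rewrite hornerX].
  by rewrite polyX_eq0.
have : p * 'X - 1 = 0.
  apply: tz; last by rewrite hornerD hornerN hornerMX pz hornerC mulVf ?subrr.
  apply: (subringB rBX); last exact: subring1.
  by apply: (subringM rBX) => //; exact: polys_overX.
move=> /(congr1 (fun q : {poly K} => q`_0)).
rewrite coefB coefMX coef1 coef0/= sub0r => /eqP.
by rewrite oppr_eq0 oner_eq0.
Qed.

(** A comparison of transcendence degrees by valuations. If [t1], [t2]
    were integral over k[y], a valuation ring containing k(t1) but not [t2] could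
    not contain y; hence y would be transcendental over k(t1), and then [t1]
    would not be integral over k[y]. Inverses are allowed because only one of t
    and 1/t may belong to a given valuation ring. *)
Lemma alg_indep_size_ge2 (K : fieldType) (B0 : set K) t1 t2 u1 u2 ys :
  subring B0 -> (forall b, B0 b -> B0 b^-1) ->
  alg_indep B0 [:: t2; t1] ->
  u1 = t1 \/ u1 = t1^-1 -> u2 = t2 \/ u2 = t2^-1 ->
  integral_closure (adj_seq B0 ys) u1 -> integral_closure (adj_seq B0 ys) u2 ->
  (2 <= size ys)%N.
Proof.
move=> rB0 B0V /= [tt2 [tt1 _]] u1E u2E ic1 ic2.
have rBt1 := adj_ring_subring t1 rB0.
pose E := fractions (adj_ring B0 t1).
have rE : subring E by exact: fractions_subring.
have B0E : B0 `<=` E.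
  by move=> b Bb; apply: fractions_base => //; exact: adj_ring_base.
have Et1 : E t1 by apply: fractions_base => //; exact: adj_ring_gen.
have tE2 : transcendental E t2 by exact: transcendental_fractions.
have tu1 : transcendental B0 u1^-1.
  by case: u1E => ->; rewrite ?invrK//; exact: transcendental_inv.
have tu2 : transcendental E u2^-1.
  by case: u2E => ->; rewrite ?invrK//; exact: transcendental_inv.
have Eu1V : E u1^-1.
  by case: u1E => ->; rewrite ?invrK//; exact: fractions_inv.
have [W [vW EW nWu2]] : exists W, [/\ vring W, E `<=` W & ~ W u2].
  have := transcendental_inv_notin rE tu2; rewrite invrK.
  move=> /(vring_omit rE)[W [vW EW nW]]; exists W; split=> //.
  by apply: subset_trans EW; exact: adj_ring_base.
have rW := vW.1; case: ys ic1 ic2 => [|y [|y' ys]] //= ic1 ic2; exfalso.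
  by apply: nWu2; apply: ic2 => //; exact: subset_trans EW.
have nWy : ~ W y.
  move=> Wy; apply: nWu2; apply: ic2 => //; apply: adj_ring_min => //.
  exact: subset_trans EW.
have tEy : transcendental E y.
  move=> p Ep py; have [//|p0] := eqVneq p 0; exfalso; apply: nWy.
  apply: (vring_root vW (polys_overS EW Ep) p0); last by rewrite rootE py.
  by apply: EW; apply: fractions_inv => //; exact: Ep.
have rBy := adj_ring_subring y rB0.
have nu1 : ~ adj_ring (adj_ring B0 y) u1^-1 u1.
  move=> h; pose V := adj_ring B0 u1^-1.
  have rV : subring V by exact: adj_ring_subring.
  have VE : V `<=` E by exact: adj_ring_min.
  have [c Vc cu1] : adj_ring V y u1.
    have rVy := adj_ring_subring y rV; have V_sub := @adj_ring_base _ V y rV.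
    move: u1 h @V rV VE rVy V_sub {Eu1V tu1 u1E ic1} => u1 + V rV VE rVy V_sub.
    apply: adj_ring_min => //; last by apply: V_sub; exact: adj_ring_gen.
    apply: adj_ring_min => //; last exact: adj_ring_gen.
    by move=> b Bb; apply: V_sub; exact: adj_ring_base.
  have Eu1 : E u1 by rewrite -[u1]invrK; exact: fractions_inv.
  have /eqP : c - u1%:P = 0.
    apply: tEy; last by rewrite hornerD hornerN hornerC cu1 subrr.
    apply: (subringB (polys_over_subring rE)); first exact: polys_overS Vc.
    exact: polys_overC.
  rewrite subr_eq0 => /eqP cE.
  apply: (transcendental_inv_notin rB0 tu1); rewrite invrK.
  by have := Vc 0%N; rewrite cE coefC.
have [W2 [vW2 ByW2 nW2]] := vring_omit rBy nu1.
by apply: nW2; apply: ic1 => //; apply: subset_trans ByW2; exact: adj_ring_base.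
Qed.

(** * Residue field and composite valuation rings *)

Module ResidueField.
Section Residue.
Variables (K : fieldType) (A : set K).
Hypothesis vA : vring A.
Let rA := vring_subring vA.

(* The residue field is a quotient of the type K rather than of the subset A,
   the elements outside A being identified with 0. *)
Definition trunc (x : K) : K := if `[< A x >] then x else 0.

Lemma truncP x : A (trunc x).
Proof. by rewrite /trunc; case: asboolP => // _; exact: subring0. Qed.

Lemma trunc_id x : A x -> trunc x = x.
Proof. by move=> Ax; rewrite /trunc asboolT. Qed.

Definition cong (x y : K) : bool := `[< mideal A (trunc x - trunc y) >].

Lemma cong_refl : reflexive cong.
Proof. by move=> x; apply/asboolP; rewrite subrr; exact: mideal0. Qed.

Lemma cong_sym : symmetric cong.
Proof.
by move=> x y; apply/asboolP/asboolP => h; rewrite -opprB; exact: midealN.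
Qed.

Lemma cong_trans : transitive cong.
Proof.
move=> y x z /asboolP xy /asboolP yz; apply/asboolP.
by rewrite -(subrKA (trunc y)); exact: midealD.
Qed.

Canonical cong_equiv := EquivRel cong cong_refl cong_sym cong_trans.

Local Open Scope quotient_scope.
Definition kappa := {eq_quot cong_equiv}.
HB.instance Definition _ := Choice.on kappa.

Definition res (x : K) : kappa := (\pi_({eq_quot cong_equiv}) x)%qT.

Lemma res_eq x y : A x -> A y -> (res x = res y) <-> mideal A (x - y).
Proof.
move=> Ax Ay; split=> [/eqquotP/asboolP|m].
  by rewrite !trunc_id.
by apply/eqquotP/asboolP; rewrite !trunc_id.
Qed.

Lemma res_surj z : exists2 x, A x & res x = z.
Proof.
exists (trunc (repr z)); first exact: truncP.
rewrite -[z in RHS]reprK; apply/eqquotP/asboolP.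
by rewrite trunc_id ?subrr; [exact: mideal0|exact: truncP].
Qed.

Definition rep (z : kappa) : K := xget 0 [set x | A x /\ res x = z].

Lemma repP z : A (rep z) /\ res (rep z) = z.
Proof.
have [x Ax xz] := res_surj z.
by apply: (@xgetPex _ 0 [set x | A x /\ res x = z]); exists x.
Qed.

Lemma rep_res x : A x -> mideal A (rep (res x) - x).
Proof. by move=> Ax; apply/res_eq => //; [exact: (repP _).1|exact: (repP _).2]. Qed.

Definition addk (x y : kappa) : kappa := res (rep x + rep y).
Definition oppk (x : kappa) : kappa := res (- rep x).
Definition mulk (x y : kappa) : kappa := res (rep x * rep y).
Definition invk (x : kappa) : kappa :=
  if x == res 0 then res 0 else res (rep x)^-1.

Lemma addkE x y : A x -> A y -> addk (res x) (res y) = res (x + y).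
Proof.
move=> Ax Ay; have [Ax' _] := repP (res x); have [Ay' _] := repP (res y).
apply/res_eq; [exact: subringD|exact: subringD|].
by rewrite opprD addrACA; apply: midealD => //; exact: rep_res.
Qed.

Lemma mulkE x y : A x -> A y -> mulk (res x) (res y) = res (x * y).
Proof.
move=> Ax Ay; have [Ax' _] := repP (res x); have [Ay' _] := repP (res y).
apply/res_eq; [exact: subringM|exact: subringM|].
have -> : rep (res x) * rep (res y) - x * y =
    (rep (res x) - x) * rep (res y) + x * (rep (res y) - y) by ring.
by apply: midealD => //; [apply: midealM|apply: midealMl] => //; exact: rep_res.
Qed.

Lemma oppkE x : A x -> oppk (res x) = res (- x).
Proof.
move=> Ax; have [Ax' _] := repP (res x).
apply/res_eq; [exact: subringN|exact: subringN|].
by rewrite opprK addrC -opprB; apply: midealN => //; exact: rep_res.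
Qed.

Let A0 : A 0. Proof. exact: subring0. Qed.
Let A1 : A 1. Proof. exact: subring1. Qed.

Lemma addkA : associative addk.
Proof.
move=> a b c; have [x Ax <-] := res_surj a; have [y Ay <-] := res_surj b.
have [z Az <-] := res_surj c.
by rewrite !addkE ?addrA//; exact: subringD.
Qed.

Lemma addkC : commutative addk.
Proof. by move=> a b; rewrite /addk addrC. Qed.

Lemma add0k : left_id (res 0) addk.
Proof. by move=> a; have [x Ax <-] := res_surj a; rewrite addkE ?add0r. Qed.

Lemma addNk : left_inverse (res 0) oppk addk.
Proof.
move=> a; have [x Ax <-] := res_surj a.
by rewrite oppkE// addkE ?addNr//; exact: subringN.
Qed.

HB.instance Definition _ := GRing.isZmodule.Build kappa addkA addkC add0k addNk.

Lemma mulkA : associative mulk.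
Proof.
move=> a b c; have [x Ax <-] := res_surj a; have [y Ay <-] := res_surj b.
have [z Az <-] := res_surj c.
by rewrite !mulkE ?mulrA//; exact: subringM.
Qed.

Lemma mulkC : commutative mulk.
Proof. by move=> a b; rewrite /mulk mulrC. Qed.

Lemma mul1k : left_id (res 1) mulk.
Proof. by move=> a; have [x Ax <-] := res_surj a; rewrite mulkE ?mul1r. Qed.

Lemma mulkDl : left_distributive mulk addk.
Proof.
move=> a b c; have [x Ax <-] := res_surj a; have [y Ay <-] := res_surj b.
have [z Az <-] := res_surj c.
have Axz : A (x * z) by exact: subringM.
have Ayz : A (y * z) by exact: subringM.
have Axy : A (x + y) by exact: subringD.
by rewrite !(addkE, mulkE)// mulrDl.
Qed.

Lemma onek_neq0 : res 1 != res 0.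
Proof.
by apply/eqP => /(res_eq A1 A0); rewrite subr0; exact: mideal1.
Qed.

HB.instance Definition _ := GRing.Zmodule_isComNzRing.Build kappa
  mulkA mulkC mul1k mulkDl onek_neq0.

Lemma mulVk (x : kappa) : x != 0 -> invk x * x = 1.
Proof.
rewrite /invk => x0; rewrite (negPf x0); have [Ax xE] := repP x.
have nmx : ~ mideal A (rep x).
  move=> mx; move/negP: x0; apply; apply/eqP; rewrite -xE; apply/res_eq => //.
  by rewrite subr0.
have x0' : rep x != 0 by apply/eqP => e; apply: nmx; left.
rewrite -{2}xE; have := mulkE (midealV Ax nmx) Ax; rewrite mulVf//.
Qed.

Lemma invk0 : invk 0 = 0.
Proof. by rewrite /invk eqxx. Qed.

HB.instance Definition _ := GRing.ComNzRing_isField.Build kappa mulVk invk0.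

Definition kappa_field : fieldType := kappa.

End Residue.
End ResidueField.

Lemma residue_field (K : fieldType) (A : set K) : vring A ->
  exists (kappa : fieldType) (res : K -> kappa),
    [/\ res 1 = 1,
        forall x y, A x -> A y -> res (x + y) = res x + res y,
        forall x y, A x -> A y -> res (x * y) = res x * res y,
        forall x, A x -> (res x = 0 <-> mideal A x) &
        forall z, exists2 x, A x & res x = z].
Proof.
move=> vA; exists (ResidueField.kappa_field vA), (@ResidueField.res K A vA); split => //.
- by move=> x y Ax Ay; rewrite -(ResidueField.addkE vA).
- by move=> x y Ax Ay; rewrite -(ResidueField.mulkE vA).
- move=> x Ax; have := ResidueField.res_eq vA Ax (subring0 vA.1).
  by rewrite subr0.
- exact: ResidueField.res_surj.
Qed.

(** * Isolated valuation rings *)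

Section Isolated.
Variables (K : fieldType) (B0 A : set K).
Hypotheses (rB0 : subring B0) (B0V : forall b, B0 b -> B0 b^-1).
Hypotheses (vA : vring A) (B0A : B0 `<=` A).
Let rA := vring_subring vA.

(** The valuation ring [A] is the only point of a basic open set of the patch
    topology. *)
Definition isolated_by (S T : seq K) : Prop :=
  [/\ forall x, x \in S -> A x, forall x, x \in T -> mideal A x &
      forall W, vring W -> B0 `<=` W -> (forall x, x \in S -> W x) ->
        (forall x, x \in T -> mideal W x) -> W = A].

(** A valuation ring W of the residue field composes with [A] to a smaller
    valuation ring, whose maximal ideal contains that of [A]. Were the residue
    ring of k[S] not algebraic over k, then by Noether normalization some W
    would contain it without being the whole residue field. *)
Lemma isolated_residue_algebraic S T y : isolated_by S T -> adj_seq B0 S y ->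
  exists q : {poly K}, [/\ q \is monic, polys_over B0 q & mideal A q.[y]].
Proof.
move=> [SA TA iso] Sy.
have [kappa [res [res1 resD resM res0 ressurj]]] := residue_field vA.
have resN x : A x -> res (- x) = - res x.
  move=> Ax; apply/eqP; rewrite -addr_eq0 -resD ?addNr//; last exact: subringN.
  by apply/eqP/res0; [exact: subring0|exact: mideal0].
have resB x z : A x -> A z -> res (x - z) = res x - res z.
  by move=> Ax Az; rewrite resD ?resN//; exact: subringN.
pose C0 := res @` B0.
have rC0 : subring C0.
  split; first by exists 1; [exact: subring1|].
    move=> _ _ [a Ba <-] [b Bb <-]; exists (a - b); first exact: subringB.
    by rewrite resB//; exact: B0A.
  move=> _ _ [a Ba <-] [b Bb <-]; exists (a * b); first exact: subringM.
  by rewrite resM//; exact: B0A.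
have C0V c : C0 c -> C0 c^-1.
  move=> [b Bb <-]; exists b^-1; first exact: B0V.
  have [b0|b0] := eqVneq b 0.
    have -> : b^-1 = b by rewrite b0 invr0.
    have -> : res b = 0 by apply/res0; [exact: B0A|left].
    by rewrite invr0.
  have e : res b * res b^-1 = 1.
    by rewrite -resM ?mulfV//; apply: B0A => //; exact: B0V.
  have rb0 : res b != 0 by apply/eqP => z; move: e; rewrite z mul0r => /esym/eqP; rewrite oner_eq0.
  by rewrite -[LHS](mulKf rb0) e mulr1.
have AS : adj_seq B0 S `<=` A by exact: adj_seq_min.
have resS : adj_seq B0 S `<=`
    [set x | A x /\ adj_seq C0 (map res S) (res x)].
  have rC := adj_seq_subring rC0 (map res S).
  apply: adj_seq_min.
  - split; first by split; [exact: subring1|rewrite res1; exact: subring1].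
      move=> x z [Ax Cx] [Az Cz]; split; first exact: subringB.
      by rewrite resB//; exact: subringB.
    move=> x z [Ax Cx] [Az Cz]; split; first exact: subringM.
    by rewrite resM//; exact: subringM.
  - move=> b Bb; split; first exact: B0A.
    by apply: adj_seq_base => //; exists b.
  - move=> x xS; split; first exact: SA.
    by apply: adj_seq_gen => //; exact: map_f.
have [zs [izs _ _ Szs]] := noether_normalization rC0 (map res S) C0V.
have resS_ic : adj_seq C0 (map res S) `<=` integral_closure (adj_seq C0 zs).
  apply: adj_seq_min => //; first exact: integral_closure_subring.
  by apply: subset_trans (@sub_integral_closure _ _); exact: adj_seq_base.
case: zs => [|z zs] in izs Szs resS_ic *; last first.
  exfalso; have [tz _] := izs; have rzs := adj_seq_subring rC0 zs.
  have nz : ~ adj_ring (adj_seq C0 zs) z^-1^-1 z^-1.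
    by rewrite invrK; exact: transcendental_inv_notin.
  have [W [vW zsW nW]] := vring_omit rzs nz; rewrite invrK in zsW.
  have rW := vring_subring vW; apply: nW.
  have [a Aa <-] := ressurj z^-1.
  have SW x : adj_seq B0 S x -> W (res x).
    by move=> /resS[_ /resS_ic]; apply.
  pose V := [set x | A x /\ W (res x)].
  have VE : V = A; last by move: Aa; rewrite -VE => -[].
  have vV : vring V.
    split.
      split; first by split; [exact: subring1|rewrite res1; exact: subring1].
        move=> x t [Ax Wx] [At Wt]; split; first exact: subringB.
        by rewrite resB//; exact: subringB.
      move=> x t [Ax Wx] [At Wt]; split; first exact: subringM.
      by rewrite resM//; exact: subringM.
    have mV x : mideal A x -> V x.
      move=> mx; have Ax := mideal_sub vA mx; split=> //.
      by rewrite (_ : res x = 0); [exact: subring0|apply/res0].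
    move=> x; have [Ax|/vring_notin/mV] := pselect (A x); last by right.
    have [/mV|nmx] := pselect (mideal A x); first by left.
    have AxV := midealV Ax nmx.
    have x0 : x != 0 by apply/eqP => x0; apply: nmx; left.
    have rx0 : res x != 0 by apply/eqP => /res0-/(_ Ax).
    have -> : V x^-1 = (A x^-1 /\ W (res x)^-1).
      congr (_ /\ W _); apply: (mulfI rx0).
      by rewrite -resM// !mulfV.
    by case: (vW.2 (res x)) => Wx; [left|right].
  apply: iso => //.
  - by move=> b Bb; split; [exact: B0A|exact/SW/adj_seq_base].
  - by move=> x xS; split; [exact: SA|exact/SW/adj_seq_gen].
  - move=> x xT; have [->|nAx] := TA _ xT; first by left.
    by right => -[].
have /(integral_monic_root rC0)[Q [Qm CQ /rootP Qy]] : integral_closure C0 (res y).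
  by apply: resS_ic; exact: (resS _ Sy).2.
have /choice[b bP] : forall i, exists b, B0 b /\ res b = Q`_i.
  by move=> i; have [b Bb bi] := CQ i; exists b.
pose n := (size Q).-1; have sQ : size Q = n.+1.
  by rewrite prednK// lt0n size_poly_eq0 monic_neq0.
have Qn : Q`_n = 1 by rewrite -(monicP Qm) lead_coefE.
pose q := 'X^n + \poly_(i < n) b i; exists q.
have Bq : polys_over B0 q.
  apply: (subringD (polys_over_subring rB0)); first exact: polys_overXn.
  by apply: polys_over_poly => // i _; exact: (bP i).1.
have Ay : A y by exact: AS.
split=> //.
  by rewrite monicE lead_coefDl ?lead_coefXn// size_polyXn ltnS size_poly.
have resX x i : A x -> res (x ^+ i) = res x ^+ i.
  move=> Ax; elim: i => [|i IH]; first by rewrite !expr0.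
  by rewrite !exprS resM ?IH//; exact: subringX.
apply/res0; first by exact: horner_closed Bq.
rewrite -Qy hornerD hornerXn horner_poly horner_coef sQ big_ord_recr/= Qn mul1r.
have Ab i : A (b i) by exact/B0A/(bP i).1.
have AM i : A (b i * y ^+ i) by apply: subringM => //; exact: subringX.
rewrite resD ?resX//; last 2 first.
- exact: subringX.
- exact: subring_sum_ord.
rewrite addrC; congr (_ + _).
elim: {sQ Qn q Bq} n => [|m IH].
  by rewrite !big_ord0; apply/res0; [exact: subring0|exact: mideal0].
rewrite !big_ord_recr/= resD ?IH//; last exact: subring_sum_ord.
by rewrite resM ?resX ?(bP _).2//; exact: subringX.
Qed.

(** Let R be [B0][S], with S enlarged so that Noether normalization produces two
    variables at least; both become elements Y and b of the maximal ideal after replacing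
    them by polynomials. With b / Y in [A], uniqueness of [A] means that no
    valuation ring containing R, with [T] in its maximal ideal, contains Y / b in
    its maximal ideal. By [vring_exists] this is an algebraic relation, which
    says that Y divides a power of b times some [g] of R congruent to 1 modulo
    the maximal ideal. By [integral_dvd_gen], Y divides a power of [g], so that
    [g] is in the maximal ideal, which is absurd. *)
Lemma not_isolated t1 t2 S T : alg_indep B0 [:: t2; t1] -> ~ isolated_by S T.
Proof.
move=> tind [SA TA iso].
(* Only one of t and 1/t may lie in A. *)
have Asign t : exists u, A u /\ (u = t \/ u = t^-1).
  by case: (vA.2 t) => At; [exists t|exists t^-1]; split => //; [left|right].
have [u1 [Au1 u1E]] := Asign t1; have [u2 [Au2 u2E]] := Asign t2.
pose S' := [:: u1, u2 & S ++ T].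
have iso' : isolated_by S' T.
  split=> //.
    move=> x; rewrite !inE mem_cat => /or4P[/eqP->|/eqP->|/SA|/TA] //.
    exact: mideal_sub.
  move=> W vW B0W S'W TW; apply: iso => // x xS; apply: S'W.
  by rewrite !inE mem_cat xS !orbT.
have [S'A _ iso''] := iso'.
pose R := adj_seq B0 S'; have rR : subring R by exact: adj_seq_subring.
have RA : R `<=` A by exact: adj_seq_min.
have B0R : B0 `<=` R by exact: adj_seq_base.
have TR x : x \in T -> R x.
  by move=> xT; apply: adj_seq_gen => //; rewrite !inE mem_cat xT !orbT.
have [ys [iys _ ysR Sys]] := noether_normalization rB0 S' B0V.
have : (2 <= size ys)%N.
  apply: (alg_indep_size_ge2 rB0 B0V tind u1E u2E); apply: Sys.
    by rewrite !inE eqxx.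
  by rewrite !inE eqxx orbT.
case: ys iys ysR Sys => [|y [|y2 ys]] // [ty [ty2 iys]] ysR Sys _.
pose B := adj_seq B0 (y2 :: ys); have rB : subring B by exact: adj_seq_subring.
have nB : integrally_closed B by exact: integrally_closed_adj_seq.
have B0B : B0 `<=` B by exact: adj_seq_base.
have BR : B `<=` R.
  by apply: adj_seq_min => // z zys; apply: ysR; rewrite inE zys orbT.
have Ry : R y by apply: ysR; rewrite mem_head.
have By2 : B y2 by apply: adj_seq_gen => //; rewrite mem_head.
have [q1 [q1m Bq1 mq1]] := isolated_residue_algebraic iso' Ry.
have [q2 [q2m Bq2 mq2]] := isolated_residue_algebraic iso' (BR _ By2).
set b := q2.[y2] in mq2.
have Bb : B b by exact: horner_closed Bq2.
have b0 : b != 0.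
  apply/eqP => b0; move: (monic_neq0 q2m); rewrite (ty2 q2) ?eqxx//.
  by apply: polys_overS Bq2; exact: adj_seq_base.
(* Either q1(y) or q1(y) + b has valuation at most that of b. *)
have [q [qm Bq mY Ah]] : exists q : {poly K},
    [/\ q \is monic, polys_over B q, mideal A q.[y] & A (b / q.[y])].
  have Bq1' : polys_over B q1 by exact: polys_overS Bq1.
  have [Ah|/vring_notin] := pselect (A (b / q1.[y])); first by exists q1.
  rewrite invf_div => mh.
  have sq1 : (1 < size q1)%N.
    rewrite ltnNge; apply/negP => /size1_polyC q1C; apply: (mideal1 vA).
    move: mq1; rewrite {1}q1C hornerC.
    by move: (monicP q1m); rewrite {1}q1C lead_coefC => ->.
  exists (q1 + b%:P); split.
  - by rewrite monicE lead_coefDl ?(monicP q1m)// (leq_ltn_trans (size_polyC_leq1 _)).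
  - by apply: (subringD (polys_over_subring rB)) => //; exact: polys_overC.
  - by rewrite hornerD hornerC; exact: midealD.
  have Y10 : q1.[y] / b + 1 != 0.
    apply/eqP => e; apply: (mideal1 vA).
    by rewrite -[1]opprK -(addr0_eq e) opprK; exact: midealN.
  have -> : b / (q1 + b%:P).[y] = (q1.[y] / b + 1)^-1.
    rewrite hornerD hornerC -[LHS]invrK invf_div; congr (_^-1).
    by rewrite mulrDl mulfV.
  apply: midealV => //.
    by apply: subringD => //; [exact: mideal_sub|exact: subring1].
  move=> m1; apply: (mideal1 vA); rewrite -[1](addKr (q1.[y] / b)).
  by apply: midealD => //; exact: midealN.
pose Y := q.[y]; rewrite -/Y in mY Ah.
have rBX := polys_over_subring rB.
have sq : (1 < size q)%N.
  rewrite ltnNge; apply/negP => /size1_polyC qC; apply: (mideal1 vA).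
  move: mY; rewrite /Y qC hornerC.
  by move: (monicP qm); rewrite {1}qC lead_coefC => ->.
have tY : transcendental B Y.
  move=> p Bp pY; apply/eqP; rewrite -(comp_poly_eq0 p sq); apply/eqP; apply: ty.
    rewrite comp_polyE; apply: (subring_sum_ord rBX) => i.
    by apply: polys_overZ => //; exact: (subringX rBX).
  by rewrite horner_comp.
pose P := adj_ring B Y; have rP : subring P by exact: adj_ring_subring.
have BP : B `<=` P by exact: adj_ring_base.
have BA : B `<=` A by exact: subset_trans RA.
have PA : P `<=` A by apply: adj_ring_min => //; exact: mideal_sub.
have icP := integral_closure_subring P.
have ic_y : integral_closure P y.
  move=> W vW PW; have rW := vring_subring vW.
  have ltq : (size (- Y%:P : {poly K}) < size q)%N.
    by rewrite size_polyN; exact: leq_ltn_trans (size_polyC_leq1 _) sq.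
  have lm : lead_coef (q - Y%:P) = 1 by rewrite lead_coefDl// (monicP qm).
  apply: (@vring_root _ _ vW (q - Y%:P)).
  - apply: (subringB (polys_over_subring rW)).
      by apply: polys_overS Bq; exact: subset_trans PW.
    by apply: polys_overC => //; apply: PW; exact: adj_ring_gen.
  - by rewrite -lead_coef_eq0 lm oner_eq0.
  - by rewrite lm invr1; exact: subring1.
  - by rewrite rootE hornerD hornerN hornerC subrr.
have P_ic := @sub_integral_closure _ P.
have R_ic : R `<=` integral_closure P.
  apply: adj_seq_min => //; first by move=> x /B0B/BP/P_ic.
  move=> x /Sys; apply: integral_closure_trans.
  by apply: adj_ring_min => // z /BP/P_ic.
have RY : R Y by exact: horner_closed Bq.
have Y0 : Y != 0.
  apply/eqP => Y0; have /eqP : 'X = 0 :> {poly K}.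
    by apply: tY; [exact: polys_overX|rewrite hornerX].
  by rewrite polyX_eq0.
pose w := Y / b; pose T' := [set x | x \in T \/ x = w].
have rRw := adj_ring_subring w rR.
have span1 : ideal_span T' (adj_ring R w) 1.
  apply: contrapT => /(vring_exists rRw)[].
    move=> x [/TR Rx| ->]; [exact: adj_ring_base|exact: adj_ring_gen].
  move=> W [vW RwW T'W].
  have RW : R `<=` W by apply: subset_trans RwW; exact: adj_ring_base.
  have WA : W = A.
    apply: iso'' => //.
    - exact: subset_trans RW.
    - by move=> x xS; apply: RW; exact: adj_seq_gen.
    - by move=> x xT; apply: T'W; left.
  have : mideal A w by rewrite -WA; apply: T'W; right.
  case=> [/eqP|]; first by rewrite mulf_eq0 invr_eq0 (negPf Y0) (negPf b0).
  by rewrite invf_div.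
have span_poly x : ideal_span T' (adj_ring R w) x -> exists a : {poly K},
    [/\ polys_over R a, mideal A a`_0 & x = a.[w]].
  have rRX := polys_over_subring rR.
  elim=> [|t _ x' T't [p Rp <-] _ [a [Ra ma ->]]].
    exists 0; split; [exact: subring0|rewrite coef0; exact: mideal0|by rewrite horner0].
  case: T't => [tT| ->].
    exists (t *: p + a); split.
    - by apply: (subringD rRX) => //; apply: polys_overZ => //; exact: TR.
    - rewrite coefD coefZ; apply: midealD => //; apply: midealM => //; first exact: TA.
      exact/RA/Rp.
    - by rewrite hornerD hornerZ.
  exists (p * 'X + a); split.
  - apply: (subringD rRX) => //; apply: (subringM rRX) => //; exact: polys_overX.
  - by rewrite coefD coefMX add0r.
  - by rewrite hornerD hornerMX mulrC.
have [a [Ra ma0 a1]] := span_poly _ span1.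
(* The relation 1 = a(w), with w = Y / b, cleared of its denominators. *)
pose g := 1 - a`_0; pose n := (size a).-1.
have sa : size a = n.+1.
  rewrite prednK// lt0n size_poly_eq0; apply/eqP => a0.
  by move/eqP: a1; rewrite a0 horner0 oner_eq0.
pose r := \sum_(j < n) a`_j.+1 * Y ^+ j * b ^+ (n - j.+1).
have gE : g * b ^+ n = Y * r.
  have -> : g = \sum_(j < n) a`_j.+1 * w ^+ j.+1.
    apply/eqP; rewrite subr_eq; apply/eqP.
    by rewrite [LHS]a1 horner_coef sa big_ord_recl expr0 mulr1 addrC.
  rewrite mulr_suml mulr_sumr; apply: eq_bigr => j _.
  have -> : b ^+ n = b ^+ (n - j.+1) * b ^+ j.+1 by rewrite -exprD subnK.
  rewrite expr_div_n [Y ^+ j.+1]exprS; field.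
  by rewrite expf_neq0.
have Rg : R g by apply: (subringB rR); [exact: subring1|exact: Ra].
have Rr : R r.
  apply: (subring_sum_ord rR) => j; apply: (subringM rR).
    by apply: (subringM rR); [exact: Ra|exact: (subringX rR)].
  by apply: (subringX rR); exact: BR.
have [N [c [cY gN]]] := integral_dvd_gen rB nB tY (subringX rB n Bb)
  (expf_neq0 n b0) (R_ic _ Rg) (R_ic _ Rr) gE.
have mg : mideal A g.
  apply: (@mideal_pow _ _ vA _ N); first exact: RA.
  rewrite gN; apply: midealN => //; apply: mideal_sum_ord => // i.
  have [c' Pc' ->] := cY i (ltn_ord i).
  apply: midealM => //; last by apply: subringX => //; exact: RA.
  by apply: midealM => //; exact: PA.
by apply: (mideal1 vA); rewrite -[1](subrK a`_0); exact: midealD.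
Qed.

End Isolated.

(** * The base field *)

Section Base.
Variables (k K : fieldType) (iota : {rmorphism k -> K}).

Lemma range_rmorph_subring : subring (range iota).
Proof.
split; first by exists 1; rewrite ?rmorph1.
- by move=> _ _ [a _ <-] [b _ <-]; exists (a - b); rewrite ?rmorphB.
- by move=> _ _ [a _ <-] [b _ <-]; exists (a * b); rewrite ?rmorphM.
Qed.

Lemma range_rmorph_inv b : range iota b -> range iota b^-1.
Proof. by move=> [a _ <-]; exists a^-1; rewrite ?fmorphV. Qed.

Lemma polys_over_range p : polys_over (range iota) p ->
  exists f : nat -> k, forall i, p`_i = iota (f i).
Proof.
move=> Bp; have /choice[f fP] : forall i, exists a, p`_i = iota a.
  by move=> i; have [a _ <-] := Bp i; exists a.
by exists f.
Qed.

Lemma trdeg_ge2_alg_indep d : has_trdeg iota d -> (2 <= d)%N ->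
  exists t1 t2, alg_indep (range iota) [:: t2; t1].
Proof.
move=> [B [indB _]] d2.
pose i1 := Ordinal (ltnW d2); pose i2 := Ordinal d2.
have biv f M N := @alg_independent_bivariate _ _ iota d B i1 i2 f M N isT indB.
exists (tnth B i1), (tnth B i2); split; last split=> //.
  move=> p /= Bp pt2.
  have /choice[c cP] : forall j, exists c : {poly K},
      polys_over (range iota) c /\ c.[tnth B i1] = p`_j.
    by move=> j; have [c Bc cj] := Bp j; exists c.
  have /choice[f fP] : forall j, exists f : nat -> k, forall i, (c j)`_i = iota (f i).
    by move=> j; apply: polys_over_range; exact: (cP j).1.
  pose M := \max_(j < size p) size (c j).
  have cE j : (j < size p)%N -> p`_j = \sum_(i < M) iota (f j i) * tnth B i1 ^+ i.
    move=> ltj; rewrite -(cP j).2 (@horner_coef_wide _ M).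
      by apply: eq_bigr => i _; rewrite fP.
    exact: (leq_bigmax (Ordinal ltj)).
  have f0 := biv (fun i j => f j i) M (size p).
  apply/polyP => j; rewrite coef0; have [lej|ltj] := leqP (size p) j.
    exact: nth_default.
  rewrite cE// big1// => i _; rewrite f0 ?rmorph0 ?mul0r//.
  rewrite -[RHS]pt2 horner_coef; apply: eq_bigr => l _.
  by rewrite cE// mulr_suml.
move=> p /= Bp pt1; have [f fP] := polys_over_range Bp.
apply/polyP => i; rewrite coef0; have [lei|lti] := leqP (size p) i.
  exact: nth_default.
rewrite fP (biv (fun i _ => f i) (size p) 1%N _ i 0%N) ?rmorph0//.
rewrite big_ord1 -[RHS]pt1 horner_coef; apply: eq_bigr => l _.
by rewrite expr0 mulr1 fP.
Qed.

(** Every element of K is the value of an expression tree built with the field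
    operations from the elements of k and finitely many generators. *)
Lemma finitely_generated_countable :
  countable [set: k] -> finitely_generated iota -> countable [set: K].
Proof.
move=> ck [S Sgen].
have [e einj] : exists e : k -> nat, injective e.
  by have /countable_injP[e einj] := ck; exists e => x y /einj; apply; rewrite inE.
pose dec n : k := xget 0 [set a | e a = n].
have decK a : dec (e a) = a.
  by apply: einj; apply: (@xgetPex _ 0 [set b | e b = e a]); exists a.
pose ev := fix ev (t : GenTree.tree (nat + nat)) : K :=
  match t with
  | GenTree.Leaf (inl n) => iota (dec n)
  | GenTree.Leaf (inr i) => S`_i
  | GenTree.Node 0 [:: a; b] => ev a - ev b
  | GenTree.Node 1 [:: a; b] => ev a / ev b
  | _ => 0
  end.
have evT : [set: K] `<=` range ev.
  move=> x _; have : adjoin iota S x by rewrite Sgen.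
  pose F : {pred K} := [pred y | `[< range ev y >]].
  move=> /(_ F) xF; suff /asboolP : x \in F by [].
  apply: xF.
  - split.
    + apply/asboolP; exists (GenTree.Leaf (inl (e 1))) => //=.
      by rewrite decK rmorph1.
    + move=> _ _ /asboolP[a _ <-] /asboolP[b _ <-]; apply/asboolP.
      by exists (GenTree.Node 0 [:: a; b]).
    + move=> _ _ /asboolP[a _ <-] /asboolP[b _ <-]; apply/asboolP.
      by exists (GenTree.Node 1 [:: a; b]).
  - move=> a; apply/asboolP.
    by exists (GenTree.Leaf (inl (e a))) => //=; rewrite decK.
  - move=> s sS; apply/asboolP.
    by exists (GenTree.Leaf (inr (index s S))) => //=; rewrite nth_index.
apply: sub_countable (subset_card_le evT) _.
exact: (sub_countable (card_image_le ev setT) (countableP _)).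
Qed.

End Base.

(** * Valuation rings as rings of valuations *)

Section ValuationRing.
Variables (K : fieldType) (v : valuation K).
Let vG := value_group v.

Lemma vfun_some x : x != 0 -> exists g : vG, v x = Some g.
Proof. by case E: (v x) => [g|] x0; [exists g|move/vfun_oo: E x0 => ->; rewrite eqxx]. Qed.

Lemma vfun1 : v 1 = Some 0.
Proof.
have [g vg] := vfun_some (oner_neq0 K); have := vfunM v 1 1.
by rewrite mulr1 vg => -[/eqP]; rewrite -subr_eq0 opprD addNKr oppr_eq0 => /eqP ->.
Qed.

Lemma vfunV x g : v x = Some g -> v x^-1 = Some (- g).
Proof.
move=> vx; have x0 : x != 0.
  by apply/eqP => x0; have := (vfun_oo v x).2 x0; rewrite vx.
have [h vh] := vfun_some (invr_neq0 x0); have := vfunM v x x^-1.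
rewrite mulfV// vfun1 vx vh => -[/esym/eqP].
by rewrite addrC addr_eq0 => /eqP ->.
Qed.

Lemma value_oppr_ge0 (g : vG) : (0 <= - g) = (g <= 0).
Proof.
apply/idP/idP; first by move/(value_leD g); rewrite add0r addNr.
by move/(value_leD (- g)); rewrite add0r addrN.
Qed.

Lemma vfunN1 : v (-1) = Some 0.
Proof.
have m10 : (-1 : K) != 0 by rewrite oppr_eq0 oner_neq0.
have [h vh] := vfun_some m10; have := vfunM v (-1) (-1).
rewrite mulrNN mulr1 vfun1 vh => -[hh].
have h_opp : - h = h by apply/eqP; rewrite eq_sym -addr_eq0 -hh.
suff -> : h = 0 by [].
have le_h0 : (0 <= h) = (h <= 0) by rewrite -value_oppr_ge0 h_opp.
apply/le_anti; have := value_total h 0.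
by rewrite le_h0 orbb => ->.
Qed.

Lemma valuation_ring_vring : vring (valuation_ring v).
Proof.
split; first split.
- by rewrite /valuation_ring/= vfun1 /=.
- have vDge0 x y : ext_le (Some 0) (v x) -> ext_le (Some 0) (v y) ->
    ext_le (Some 0) (v (x + y)).
    move=> vx vy; have := vfunD v x y; rewrite /ext_min.
    case: ifP => _; case: (v (x + y)) => // g.
      by move: vx; case: (v x) => //= h h0; exact: le_trans.
    by move: vy; case: (v y) => //= h h0; exact: le_trans.
  move=> x y vx vy; apply: vDge0 => //; rewrite -mulN1r vfunM vfunN1.
  by move: vy; rewrite /valuation_ring/=; case: (v y) => //= g; rewrite add0r.
- move=> x y; rewrite /valuation_ring/= vfunM.
  case: (v x) (v y) => [g|] [h|] //= g0 h0.
  by apply: le_trans h0 _; have := value_leD h g0; rewrite add0r.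
move=> x; have [->|x0] := eqVneq x 0.
  by left; rewrite /valuation_ring/= (vfun_oo v 0).2.
have [g vx] := vfun_some x0; rewrite /valuation_ring/= (vfunV vx) vx /=.
by rewrite value_oppr_ge0; apply/orP; exact: value_total.
Qed.

Lemma mideal_valuation_ring x :
  mideal (valuation_ring v) x <-> ext_lt (Some 0) (v x).
Proof.
rewrite /mideal/= /valuation_ring/= /ext_lt; have [->|x0] := eqVneq x 0.
  by rewrite (vfun_oo v 0).2//; split=> // _; left.
have [g vx] := vfun_some x0; rewrite (vfunV vx) vx /= value_oppr_ge0.
split=> [[/eqP|/negP ng0]|/andP[g0 ne]]; first by rewrite (negPf x0).
  have := value_total 0 g; rewrite (negPf ng0) orbF => g0; rewrite g0/=.
  by apply: contra ng0 => /eqP [<-].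
right=> g0'; move/negP: ne; apply; apply/eqP; congr Some.
by apply/le_anti; rewrite g0 g0'.
Qed.

End ValuationRing.

Module ValueGroup.
Section ValueGroup.
Variables (K : fieldType) (A : set K).
Hypothesis vA : vring A.
Let rA := vring_subring vA.

(* The quotient is taken on all of K, with 0 in the class of 1. *)
Definition nz (x : K) : K := if x == 0 then 1 else x.

Lemma nz_neq0 x : nz x != 0.
Proof. by rewrite /nz; case: ifPn => // _; exact: oner_neq0. Qed.

Lemma nz_id x : x != 0 -> nz x = x.
Proof. by rewrite /nz => /negPf ->. Qed.

Definition assoc (x y : K) : bool :=
  `[< A (nz x / nz y) /\ A (nz y / nz x) >].

Lemma assoc_refl : reflexive assoc.
Proof.
by move=> x; apply/asboolP; rewrite divff ?nz_neq0//; split; exact: subring1.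
Qed.

Lemma assoc_sym : symmetric assoc.
Proof. by move=> x y; apply/asboolP/asboolP => -[]. Qed.

Lemma divA x y z : y != 0 -> A (x / y) -> A (y / z) -> A (x / z).
Proof. by move=> y0 xy yz; rewrite -(divfK y0 x) -mulrA; exact: (subringM rA). Qed.

Lemma assoc_trans : transitive assoc.
Proof.
move=> y x z /asboolP[xy yx] /asboolP[yz zy]; apply/asboolP.
by split; apply: (@divA _ (nz y)) => //; exact: nz_neq0.
Qed.

Canonical assoc_equiv := EquivRel assoc assoc_refl assoc_sym assoc_trans.
Local Open Scope quotient_scope.
Definition G := {eq_quot assoc_equiv}.
HB.instance Definition _ := Choice.on G.

Definition cls (x : K) : G := \pi_({eq_quot assoc_equiv}) x.

Lemma cls_eq x y : x != 0 -> y != 0 ->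
  (cls x = cls y) <-> (A (x / y) /\ A (y / x)).
Proof.
move=> x0 y0; split=> [/eqquotP/asboolP|m]; first by rewrite !nz_id.
by apply/eqquotP/asboolP; rewrite !nz_id.
Qed.

Lemma cls_surj z : exists2 x, x != 0 & cls x = z.
Proof.
exists (nz (repr z)); first exact: nz_neq0.
rewrite -[z in RHS]reprK; apply/eqquotP/asboolP.
by rewrite [nz (nz _)]nz_id ?divff ?nz_neq0//; split; exact: subring1.
Qed.

Definition rep (z : G) : K := xget 1 [set x | x != 0 /\ cls x = z].

Lemma repP z : rep z != 0 /\ cls (rep z) = z.
Proof.
have [x x0 xz] := cls_surj z.
by apply: (@xgetPex _ 1 [set x | x != 0 /\ cls x = z]); exists x.
Qed.

Lemma rep_cls x : x != 0 -> A (rep (cls x) / x) /\ A (x / rep (cls x)).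
Proof. by move=> x0; apply/cls_eq => //; [exact: (repP _).1|exact: (repP _).2]. Qed.

Definition addg (x y : G) : G := cls (rep x * rep y).
Definition oppg (x : G) : G := cls (rep x)^-1.
Definition leg (x y : G) : bool := `[< A (rep y / rep x) >].

Lemma addgE x y : x != 0 -> y != 0 -> addg (cls x) (cls y) = cls (x * y).
Proof.
move=> x0 y0; have [x0' _] := repP (cls x); have [y0' _] := repP (cls y).
have [Ax Ax'] := rep_cls x0; have [Ay Ay'] := rep_cls y0.
apply/cls_eq; [exact: mulf_neq0|exact: mulf_neq0|].
by split; rewrite invfM mulrACA; exact: (subringM rA).
Qed.

Lemma oppgE x : x != 0 -> oppg (cls x) = cls x^-1.
Proof.
move=> x0; have [x0' _] := repP (cls x); have [Ax Ax'] := rep_cls x0.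
apply/cls_eq; rewrite ?invr_eq0//.
by rewrite !invrK ![_^-1 * _]mulrC.
Qed.

Lemma legE x y : x != 0 -> y != 0 -> leg (cls x) (cls y) = `[< A (y / x) >].
Proof.
move=> x0 y0; have [x0' _] := repP (cls x); have [y0' _] := repP (cls y).
have [Ax Ax'] := rep_cls x0; have [Ay Ay'] := rep_cls y0.
apply: asbool_equiv_eq; split=> h.
  by apply: (divA y0' Ay'); exact: (divA x0' h).
by apply: (divA y0 Ay); exact: (divA x0 h).
Qed.

Lemma addgA : associative addg.
Proof.
move=> a b c; have [x x0 <-] := cls_surj a; have [y y0 <-] := cls_surj b.
have [z z0 <-] := cls_surj c.
by rewrite !addgE ?mulf_neq0// mulrA.
Qed.

Lemma addgC : commutative addg.
Proof. by move=> a b; rewrite /addg mulrC. Qed.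

Lemma add0g : left_id (cls 1) addg.
Proof.
by move=> a; have [x x0 <-] := cls_surj a; rewrite addgE ?mul1r ?oner_neq0.
Qed.

Lemma addNg : left_inverse (cls 1) oppg addg.
Proof.
move=> a; have [x x0 <-] := cls_surj a.
by rewrite oppgE// addgE ?invr_eq0// mulVf.
Qed.

Lemma leg_refl : reflexive leg.
Proof.
move=> a; have [x x0 <-] := cls_surj a; rewrite legE//; apply/asboolP.
by rewrite divff//; exact: subring1.
Qed.

Lemma leg_anti : antisymmetric leg.
Proof.
move=> a b; have [x x0 <-] := cls_surj a; have [y y0 <-] := cls_surj b.
by rewrite !legE// => /andP[/asboolP yx /asboolP xy]; apply/cls_eq.
Qed.

Lemma leg_trans : transitive leg.
Proof.
move=> b a c; have [x x0 <-] := cls_surj a; have [y y0 <-] := cls_surj b.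
have [z z0 <-] := cls_surj c; rewrite !legE// => /asboolP h1 /asboolP h2.
by apply/asboolP; exact: divA h2 h1.
Qed.

HB.instance Definition _ := GRing.isZmodule.Build G addgA addgC add0g addNg.
HB.instance Definition _ :=
  Order.Le_isPOrder.Build ring_display G leg_refl leg_anti leg_trans.

Definition group : porderZmodType := G.

Lemma leg_total (a b : group) : (a <= b) || (b <= a).
Proof.
have [x x0 <-] := cls_surj a; have [y y0 <-] := cls_surj b.
have -> : (cls x <= cls y :> group) = `[< A (y / x) >] := legE x0 y0.
have -> : (cls y <= cls x :> group) = `[< A (x / y) >] := legE y0 x0.
by case: (vA.2 (y / x)); rewrite ?invf_div => h; apply/orP; [left|right]; exact/asboolP.
Qed.

Lemma leg_add (c a b : group) : a <= b -> a + c <= b + c.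
Proof.
have [x x0 <-] := cls_surj a; have [y y0 <-] := cls_surj b.
have [z z0 <-] := cls_surj c.
have -> : (cls x <= cls y :> group) = `[< A (y / x) >] := legE x0 y0.
have -> : (cls x : group) + cls z = cls (x * z) := addgE x0 z0.
have -> : (cls y : group) + cls z = cls (y * z) := addgE y0 z0.
have -> : (cls (x * z) <= cls (y * z) :> group) = `[< A (y * z / (x * z)) >].
  by apply: legE; exact: mulf_neq0.
by rewrite -mulf_div divff// mulr1.
Qed.

Definition val (x : K) : option group := if x == 0 then None else Some (cls x).

Lemma val_oo x : val x = None <-> x = 0.
Proof. by rewrite /val; case: eqP; split. Qed.

Lemma valM x y : val (x * y) = ext_add (val x) (val y).
Proof.
rewrite /val mulf_eq0; case: eqP => //= /eqP x0; case: eqP => //= /eqP y0.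
by congr Some; rewrite -(addgE x0 y0).
Qed.

Lemma val_le x y : ext_le (val x) (val y) <-> exists2 a, A a & y = a * x.
Proof.
rewrite /val; have [->|x0] := eqVneq x 0; have [->|y0] := eqVneq y 0 => /=.
- by split=> // _; exists 0; [exact: subring0|rewrite mul0r].
- by split=> // -[a _]; rewrite mulr0 => /eqP; rewrite (negPf y0).
- by split=> // _; exists 0; [exact: subring0|rewrite mul0r].
have -> : (cls x <= cls y :> group) = `[< A (y / x) >] := legE x0 y0.
split=> [/asboolP Ayx|[a Aa ->]]; first by exists (y / x) => //; rewrite divfK.
by rewrite mulfK//; exact/asboolP.
Qed.

Lemma valD x y : ext_le (ext_min (val x) (val y)) (val (x + y)).
Proof.
rewrite /ext_min; case: ifPn => [/val_le[a Aa ->]|nle]; apply/val_le.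
  exists (1 + a); first by apply: subringD => //; exact: subring1.
  by rewrite mulrDl mul1r.
have [vxy|[a Aa ->]] : ext_le (val x) (val y) \/ exists2 a, A a & x = a * y.
- have [->|y0] := eqVneq y 0; first by left; rewrite /val eqxx; case: ifP.
  case: (vA.2 (y / x)) => h.
    have [->|x0] := eqVneq x 0.
      by right; exists 0; [exact: subring0|rewrite mul0r].
    by left; apply/val_le; exists (y / x) => //; rewrite divfK.
  by right; exists (x / y); [rewrite -invf_div|rewrite divfK].
- by rewrite vxy in nle.
exists (a + 1); first by apply: subringD => //; exact: subring1.
by rewrite mulrDl mul1r.
Qed.

Definition valuation_of : valuation K :=
  Valuation leg_total leg_add val_oo valM valD.

Lemma valuation_ring_of : valuation_ring valuation_of = A.
Proof.
have val1 : val 1 = Some 0 by rewrite /val oner_eq0.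
have ringE x : valuation_ring valuation_of x = ext_le (val 1) (val x).
  by rewrite val1.
apply/seteqP; split=> x; rewrite ringE.
  by move=> /val_le[a Aa ->]; rewrite mulr1.
by move=> Ax; apply/val_le; exists x; rewrite ?mulr1.
Qed.

End ValueGroup.
End ValueGroup.

(** * The patch topology *)

Section PatchTopology.
Variables (k K : fieldType) (iota : {rmorphism k -> K}).
Notation ZRK := (ZR iota).
Notation nonneg := (@zr_nonneg k K iota).
Notation pos := (@zr_pos k K iota).
Implicit Types p q : ZRK.

Lemma zr_sval_class (v : valuation K) (tv : trivial_on_base iota v) :
  sval (zr_class tv) = valuation_ring v.
Proof. by []. Qed.

Lemma zr_vring p : vring (sval p).
Proof. by have [v [tv ->]] := zr_class_surj p; exact: valuation_ring_vring. Qed.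

Lemma zr_base p : range iota `<=` sval p.
Proof.
have [v [tv ->]] := zr_class_surj p; move=> _ [a _ <-].
rewrite zr_sval_class /valuation_ring/=; have [->|a0] := eqVneq a 0.
  by rewrite rmorph0 (vfun_oo v 0).2.
by rewrite tv.
Qed.

Lemma zr_of_vring (A : set K) : vring A -> range iota `<=` A ->
  exists p, sval p = A.
Proof.
move=> vA iA.
have [v vring_v] : exists v : valuation K, valuation_ring v = A.
  by exists (ValueGroup.valuation_of vA); exact: ValueGroup.valuation_ring_of.
suff tv : trivial_on_base iota v by exists (zr_class tv); rewrite zr_sval_class.
move=> a a0; have ia0 : iota a != 0 by rewrite fmorph_eq0.
have [g vg] := vfun_some v ia0.
have ge0 : 0 <= g.
  have : valuation_ring v (iota a) by rewrite vring_v; apply: iA; exists a.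
  by rewrite /valuation_ring/= vg.
have le0 : g <= 0.
  have : valuation_ring v (iota a)^-1.
    by rewrite vring_v; apply/iA/range_rmorph_inv; exists a.
  by rewrite /valuation_ring/= (vfunV vg)/= value_oppr_ge0.
by apply: (etrans vg); congr Some; apply/le_anti; rewrite ge0 le0.
Qed.

Lemma zr_ext p q : sval p = sval q -> p = q.
Proof. by case: p q => [A hA] [B hB] /= e; exact: eq_exist. Qed.

Lemma zr_nonnegE x p : nonneg x p <-> sval p x.
Proof.
split=> [[v [tv [-> vx]]] //|]; have [v [tv ->]] := zr_class_surj p => vx.
by exists v, tv.
Qed.

Lemma zr_posE x p : pos x p <-> mideal (sval p) x.
Proof.
split=> [[v [tv [-> vx]]]|]; first exact/mideal_valuation_ring.
have [v [tv ->]] := zr_class_surj p => /mideal_valuation_ring vx.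
by exists v, tv.
Qed.

Lemma zr_nbhs_sub (F : set_system ZRK) p : Filter F ->
  (forall x, sval p x -> F (nonneg x)) ->
  (forall x, mideal (sval p) x -> F (pos x)) ->
  nbhs p `<=` F.
Proof.
move=> FF Fnn Fpos A; rewrite nbhsE => -[_ [[B sB <-] [C BC Cp] sUBA]].
apply: filterS sUBA _; apply: (@filterS _ _ _ C); first by move=> ? ?; exists C.
have /sB [D sD IDeC] := BC; rewrite -IDeC; apply: filter_bigI => E DE.
have Ep : E p by move: Cp; rewrite -IDeC => /(_ _ DE).
have /sD/set_mem := DE; move=> [x [EE|EE]]; rewrite /= EE in Ep *.
  by apply: Fnn; exact/zr_nonnegE.
by apply: Fpos; exact/zr_posE.
Qed.

Lemma zr_subbase_open (E : set ZRK) : patch_subbase E -> open E.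
Proof.
move=> PE; exists [set E]; last by rewrite bigcup_set1.
move=> _ ->; exists [fset E]%fset; last by rewrite set_fset1 bigcap_set1.
by move=> ? /fset1P ->; exact: mem_set.
Qed.

Lemma zr_nonneg_open x : open (nonneg x).
Proof. by apply: zr_subbase_open; exists x; left. Qed.

Lemma zr_pos_open x : open (pos x).
Proof. by apply: zr_subbase_open; exists x; right. Qed.

Definition basic (S T : seq K) : set ZRK :=
  [set q | (forall x, x \in S -> sval q x) /\
           (forall x, x \in T -> mideal (sval q) x)].

Lemma zr_nbhsP p A :
  nbhs p A <-> exists S T, basic S T p /\ basic S T `<=` A.
Proof.
split; last first.
  move=> [S [T [[pS pT] sub]]]; apply: filterS sub _.
  have -> : basic S T = (\bigcap_(x in [set` S]) nonneg x) `&`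
      (\bigcap_(x in [set` T]) pos x).
    apply/seteqP; split=> q [qS qT]; split=> x xS.
    - exact/zr_nonnegE/qS.
    - exact/zr_posE/qT.
    - exact/zr_nonnegE/(qS x xS).
    - exact/zr_posE/(qT x xS).
  apply: filterI.
    have -> : [set` S] = [set` [fset x in S]%fset] by apply/seteqP; split=> x /=; rewrite inE.
    apply: filter_bigI => x; rewrite inE/= => xS.
    by apply: open_nbhs_nbhs; split; [exact: zr_nonneg_open|exact/zr_nonnegE/pS].
  have -> : [set` T] = [set` [fset x in T]%fset] by apply/seteqP; split=> x /=; rewrite inE.
  apply: filter_bigI => x; rewrite inE/= => xT.
  by apply: open_nbhs_nbhs; split; [exact: zr_pos_open|exact/zr_posE/pT].
pose F : set_system ZRK := [set A | exists S T, basic S T p /\ basic S T `<=` A].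
suff : nbhs p `<=` F by apply.
apply: zr_nbhs_sub.
- split.
  + by exists [::], [::].
  + move=> B C [S [T [[pS pT] sub]]] [S' [T' [[pS' pT'] sub']]].
    exists (S ++ S'), (T ++ T'); split.
      by split=> x; rewrite mem_cat => /orP[]; [exact: pS|exact: pS'|exact: pT|exact: pT'].
    move=> q [qS qT]; split; [apply: sub|apply: sub'];
      by split=> x xS; [apply: qS|apply: qT]; rewrite mem_cat xS ?orbT.
  + move=> B C BC [S [T [pST sub]]]; exists S, T; split=> //.
    exact: subset_trans BC.
- move=> x px; exists [:: x], [::]; split; first by split=> y //; rewrite inE => /eqP ->.
  by move=> q [qS _]; apply/zr_nonnegE/qS; rewrite inE.
- move=> x px; exists [::], [:: x]; split; first by split=> y //; rewrite inE => /eqP ->.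
  by move=> q [_ qT]; apply/zr_posE/qT; rewrite inE.
Qed.

Lemma zr_nonempty : [set: ZRK] !=set0.
Proof.
have [|//|p _] := @zr_of_vring setT; last by exists p.
by split; [split|left].
Qed.

(** The set of the elements of K that belong to almost all valuation rings, in
    the sense of an ultrafilter, is again a valuation ring: the limit. *)
Lemma zr_compact : compact [set: ZRK].
Proof.
rewrite compact_ultra => F FU _; have FF : ProperFilter F by exact: ultra_proper.
pose A : set K := [set x | F (nonneg x)].
have vA : vring A.
  split; first split.
  - apply: filterS filterT => p _; apply/zr_nonnegE; exact: subring1 (zr_vring p).1.
  - move=> x y Ax Ay; apply: filterS (filterI Ax Ay) => p [/zr_nonnegE px /zr_nonnegE py].
    by apply/zr_nonnegE; exact: (subringB (zr_vring p).1).
  - move=> x y Ax Ay; apply: filterS (filterI Ax Ay) => p [/zr_nonnegE px /zr_nonnegE py].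
    by apply/zr_nonnegE; exact: (subringM (zr_vring p).1).
  move=> x; have [Ax|nAx] := in_ultra_setVsetC (nonneg x) FU; first by left.
  right; apply: filterS nAx => p npx; apply/zr_nonnegE.
  by have [/zr_nonnegE//|] := (zr_vring p).2 x.
have iA : range iota `<=` A.
  by move=> x ix; apply: filterS filterT => p _; apply/zr_nonnegE; exact: zr_base.
have [p pA] := zr_of_vring vA iA; exists p; split=> //.
apply: zr_nbhs_sub => x; rewrite pA //.
case=> [->|nAx].
  by apply: filterS filterT => q _; apply/zr_posE; left.
have [//|] := in_ultra_setVsetC (nonneg x^-1) FU.
by apply: filterS => q nqx; apply/zr_posE; right => /zr_nonnegE.
Qed.

(** For nonzero [x], the complement is the open set of the valuations that are
    positive at 1/x. *)
Lemma zr_nonneg_clopen x : clopen (nonneg x).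
Proof.
split; first exact: zr_nonneg_open.
have [->|x0] := eqVneq x 0.
  have -> : nonneg 0 = setT; last exact: closedT.
  by apply/seteqP; split=> // p _; apply/zr_nonnegE; exact: subring0 (zr_vring p).1.
have -> : nonneg x = ~` pos x^-1; last exact/open_closedC/zr_pos_open.
apply/seteqP; split=> p.
  move=> /zr_nonnegE px /zr_posE[/eqP|]; first by rewrite invr_eq0 (negPf x0).
  by rewrite invrK.
move=> npx; apply/zr_nonnegE; apply: contrapT => nx; apply: npx.
by apply/zr_posE; right; rewrite invrK.
Qed.

Lemma zr_zero_dimensional : zero_dimensional ZRK.
Proof.
move=> p q /eqP pq.
have : exists x, ~ (sval p x <-> sval q x).
  apply: contrapT => /forallNP h; apply: pq; apply: zr_ext; apply/seteqP.
  by split=> x; have /contrapT[] := h x.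
move=> [x npq]; have cx := zr_nonneg_clopen x.
have [px|npx] := pselect (sval p x).
  exists (nonneg x); split=> //; first exact/zr_nonnegE.
  by move=> /zr_nonnegE qx; apply: npq.
exists (~` nonneg x); split.
- by split; [exact/closed_openC/cx.2|exact/open_closedC/cx.1].
- by move=> /zr_nonnegE.
- by apply; apply/zr_nonnegE; apply: contrapT => nqx; apply: npq.
Qed.

Section Metric.
Variables (R : realType) (c : K -> nat).
Hypothesis c_inj : injective c.
Implicit Types P : nat -> bool.

(** Applied to the set of the ranks, in an enumeration of K, of the elements on
    which two valuation rings differ, this gives an ultrametric. *)
Definition inv_first (P : nat -> bool) : R :=
  if pselect (exists n, P n) is left h then (ex_minn h).+1%:R^-1 else 0.

Lemma inv_first_ge0 P : 0 <= inv_first P.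
Proof. by rewrite /inv_first; case: pselect => // h; rewrite invr_ge0. Qed.

Lemma inv_first_lt P n :
  inv_first P < n.+1%:R^-1 <-> forall m, (m <= n)%N -> ~~ P m.
Proof.
rewrite /inv_first; case: pselect => [h|nP]; last first.
  split=> [_ m _|_]; last by rewrite invr_gt0.
  by apply/negP => Pm; apply: nP; exists m.
case: ex_minnP => l Pl minl; rewrite ltf_pV2 ?posrE// ltr_nat ltnS.
split=> [ltnl m lemn|h' ]; first by apply: contraL ltnl => /minl; rewrite -leqNgt => /leq_trans; apply.
by rewrite ltnNge; apply/negP => /h'; rewrite Pl.
Qed.

Lemma inv_first_ge P n : P n -> n.+1%:R^-1 <= inv_first P.
Proof.
by move=> Pn; rewrite leNgt; apply/negP => /inv_first_lt /(_ n (leqnn n)); rewrite Pn.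
Qed.

Lemma inv_first_eq0 P : inv_first P = 0 <-> forall n, ~~ P n.
Proof.
split=> [P0 n|nP].
  by apply/negP => /inv_first_ge; rewrite P0 leNgt invr_gt0 ltr0Sn.
rewrite /inv_first; case: pselect => // -[n Pn].
by have := nP n; rewrite Pn.
Qed.

Definition differ p q (n : nat) : bool :=
  `[< exists x, c x = n /\ ~ (sval p x <-> sval q x) >].

Definition zr_dist p q : R := inv_first (differ p q).

Lemma differP p q n :
  reflect (forall x, c x = n -> (sval p x <-> sval q x)) (~~ differ p q n).
Proof.
apply: (iffP idP) => [/asboolPn h x cx|h]; last first.
  by apply/asboolPn => -[x [cx]]; apply; exact: h.
by apply: contrapT => npq; apply: h; exists x.
Qed.

Lemma zr_dist_metric : is_metric zr_dist.
Proof.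
split.
- by move=> p q; exact: inv_first_ge0.
- move=> p q; split=> [/inv_first_eq0 h|->].
    apply: zr_ext; apply/seteqP; split=> x; by have /differP/(_ x erefl)[] := h (c x).
  by apply/inv_first_eq0 => n; apply/differP.
- move=> p q; congr inv_first; apply/funext => n; apply/idP/idP; apply: contraTT;
    by move=> /differP h; apply/differP => x cx; split => /(h x cx).
- move=> p q r; rewrite {1}/zr_dist /inv_first; case: pselect => [h|_]; last first.
    by apply: addr_ge0; exact: inv_first_ge0.
  case: ex_minnP => n prn _.
  have [pqn|/differP pqn] := boolP (differ p q n).
    by apply: ler_wpDr; [exact: inv_first_ge0|exact: inv_first_ge].
  have [qrn|/differP qrn] := boolP (differ q r n).
    by apply: ler_wpDl; [exact: inv_first_ge0|exact: inv_first_ge].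
  have /differP : forall x, c x = n -> (sval p x <-> sval r x).
    by move=> x cx; rewrite (pqn x cx) (qrn x cx).
  by rewrite prn.
Qed.

Lemma zr_dist_lt p q n :
  zr_dist p q < n.+1%:R^-1 <->
  forall x, (c x <= n)%N -> (sval p x <-> sval q x).
Proof.
split=> [/inv_first_lt h x cx|h]; first by have /differP := h _ cx; apply.
by apply/inv_first_lt => m lemn; apply/differP => x cx; apply: h; rewrite cx.
Qed.

Lemma zr_dist_nbhs p A :
  nbhs p A <-> exists2 e : R, 0 < e & [set q | zr_dist p q < e] `<=` A.
Proof.
split=> [/zr_nbhsP[S [T [[pS pT] sub]]]|[e e0 sub]].
  pose n := \max_(x <- S ++ map (@GRing.inv K) T) c x.
  exists n.+1%:R^-1; first by rewrite invr_gt0.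
  move=> q /zr_dist_lt pq; apply: sub; split=> x xS.
    apply/pq; last exact: pS.
    by apply: leq_bigmax_seq => //; rewrite mem_cat xS.
  have [->|npx] := pT x xS; [by left|right=> qx; apply: npx; apply/pq => //].
  by apply: leq_bigmax_seq => //; rewrite mem_cat map_f ?orbT.
have [n ne] : exists n, n.+1%:R^-1 <= e.
  exists (Num.truncn e^-1); rewrite -[leRHS]invrK lef_pV2 ?posrE ?invr_gt0//.
  by apply: ltW; exact: truncnS_gt.
apply: (zr_nbhsP p A).2.
pose L := [seq xget 0 [set x | c x = i] | i <- seq.iota 0 n.+1].
have inL x : (c x <= n)%N -> x \in L.
  move=> cx; apply/mapP; exists (c x); first by rewrite mem_iota/= add0n ltnS.
  by apply: c_inj; apply/esym; apply: (@xgetPex _ 0 [set y | c y = c x]); exists x.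
exists [seq x <- L | `[< sval p x >]], [seq x^-1 | x <- L & ~~ `[< sval p x >]].
split.
  split=> x; first by rewrite mem_filter => /andP[/asboolP].
  move=> /mapP[y]; rewrite mem_filter => /andP[/asboolPn npy _] ->.
  exact: vring_notin.
move=> q [qS qT]; apply: sub; apply: lt_le_trans ne; apply/zr_dist_lt => x cx.
split=> [px|]; first by apply: qS; rewrite mem_filter inL// andbT; exact/asboolP.
move=> qx; apply: contrapT => npx.
have [/eqP|] : mideal (sval q) x^-1.
- by apply: qT; apply: map_f; rewrite mem_filter inL// andbT; exact/asboolPn.
- rewrite invr_eq0 => /eqP x0; apply: npx; rewrite x0.
  exact: subring0 (zr_vring p).1.
by rewrite invrK.
Qed.

End Metric.

Lemma zr_no_isolated d : has_trdeg iota d -> (2 <= d)%N ->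
  isolated [set: ZRK] = set0.
Proof.
move=> trd d2; apply/seteqP; split=> // p [_ [V Vp]]; rewrite setIT => Vp1.
have [t1 [t2 tind]] := trdeg_ge2_alg_indep trd d2.
have /zr_nbhsP[S [T [[pS pT] sub]]] : nbhs p [set p] by rewrite -Vp1.
apply: (not_isolated (range_rmorph_subring iota) (@range_rmorph_inv _ _ iota)
  (zr_vring p) (@zr_base p) (S := S) (T := T) tind).
split=> // W vW iW SW TW; have [q qW] := zr_of_vring vW iW.
by rewrite -qW; congr sval; apply: sub; split=> x; rewrite qW; [exact: SW|exact: TW].
Qed.

End PatchTopology.

Theorem theorem4p46 (R : realType) (k K : fieldType)
    (iota : {rmorphism k -> K}) (d : nat)
    (k_countable : countable [set: k])
    (K_fg : finitely_generated iota)
    (K_trdeg : has_trdeg iota d) (d_ge2 : (2 <= d)%N) :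
  cantor_set R (ZR iota).
Proof.
have /countable_injP[c c_inj] := finitely_generated_countable k_countable K_fg.
have {}c_inj : injective c by move=> x y; apply: c_inj; rewrite in_setT.
split.
- exact: zr_nonempty.
- exact: zr_compact.
- by exists (zr_dist R c); split; [exact: zr_dist_metric|exact: zr_dist_nbhs].
- exact/zero_dimension_totally_disconnected/zr_zero_dimensional.
- exact: zr_no_isolated K_trdeg d_ge2.
Qed.
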